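(* Let $(\omega,c)\in\mathbb{R}^2$ satisfy: $\omega>c^2/4$, or $\omega=c^2/4$ and $c>0$. For $L>L_0(\omega,c)$ let $\Phi^L_{\omega,c}$ be the function on $[-L,L]$ defined below. Then for every integer $m\ge0$, $$\lim_{L\to\infty}\bigl\|\Phi^L_{\omega,c}-\Phi_{\omega,c}\bigr\|_{C^m([-L,L])}=0.$$
   Context: Set $\alpha_0=\tfrac13(4c+\sqrt{48\omega+4c^2})$, $\alpha_1=4\sqrt\omega+2c$, $A(x)=-3x^2+8cx+64\omega$, $L_0(\omega,c)=2\pi/\sqrt{\alpha_0\sqrt{A(\alpha_0)}}$. For $\eta_3\in(\alpha_0,\alpha_1)$ put $\eta_1=\frac{-\eta_3+4c-\sqrt{A(\eta_3)}}{2}$, $\eta_2=\frac{-\eta_3+4c+\sqrt{A(\eta_3)}}{2}$ (one has $\eta_1<0<\eta_2<\eta_3$), $k^2=\frac{-\eta_1(\eta_3-\eta_2)}{\eta_3(\eta_2-\eta_1)}\in(0,1)$, $g=\frac{2}{\sqrt{\eta_3(\eta_2-\eta_1)}}$, $\beta^2=-\eta_3k^2/\eta_1$, and $T(\eta_3)=4gK(k)$, where $K(k)=\int_0^{\pi/2}(1-k^2\sin^2\theta)^{-1/2}d\theta$. The map $\eta_3\mapsto T(\eta_3)$ is a strictly increasing bijection of $(\alpha_0,\alpha_1)$ onto $(2L_0,\infty)$; for $L>L_0$ let $\eta_3$ be the unique value with $T(\eta_3)=2L$, and define the positive function $\Phi^L_{\omega,c}$ on $[-L,L]$ by $(\Phi^L_{\omega,c}(x))^2=\eta_3\,\mathrm{dn}^2(\frac{x}{2g};k)/(1+\beta^2\mathrm{sn}^2(\frac{x}{2g};k))$,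 with $\mathrm{sn},\mathrm{dn}$ the Jacobi elliptic functions of modulus $k$. $\Phi_{\omega,c}$ is the function on $\mathbb{R}$ with $\Phi_{\omega,c}>0$ and $\Phi_{\omega,c}^2(x)=\frac{4\omega-c^2}{\sqrt\omega(\cosh(\sqrt{4\omega-c^2}x)-\frac{c}{2\sqrt\omega})}$ if $\omega>c^2/4$, $\Phi_{\omega,c}^2(x)=\frac{4c}{(cx)^2+1}$ if $\omega=c^2/4,\ c>0$. $\|f\|_{C^m([-L,L])}=\sum_{j=0}^m\sup_{[-L,L]}|f^{(j)}|$. *)

(* Defs.v *)
From Stdlib Require Import Reals Lra ClassicalEpsilon.
From Coquelicot Require Import Coquelicot.
Open Scope R_scope.

Definition ellF (k2 phi : R) : R :=
  RInt (fun t => / sqrt (1 - k2 * (sin t)^2)) 0 phi.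

Definition ellK (k2 : R) : R := ellF k2 (PI / 2).

(* Jacobi amplitude: the (unique, for 0 <= k2 < 1) phi with F(phi) = u. *)
Definition jam (k2 u : R) : R :=
  epsilon (inhabits 0) (fun phi => ellF k2 phi = u).

Definition jsn (k2 u : R) : R := sin (jam k2 u).
Definition jdn (k2 u : R) : R := sqrt (1 - k2 * (jsn k2 u)^2).

Definition alpha0 (w c : R) : R := (4 * c + sqrt (48 * w + 4 * c^2)) / 3.
Definition alpha1 (w c : R) : R := 4 * sqrt w + 2 * c.
Definition Apoly (w c x : R) : R := -3 * x^2 + 8 * c * x + 64 * w.
Definition L0 (w c : R) : R :=
  2 * PI / sqrt (alpha0 w c * sqrt (Apoly w c (alpha0 w c))).

Definition eta1 (w c e3 : R) : R := (- e3 + 4 * c - sqrt (Apoly w c e3)) / 2.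
Definition eta2 (w c e3 : R) : R := (- e3 + 4 * c + sqrt (Apoly w c e3)) / 2.
Definition modk2 (w c e3 : R) : R :=
  (- eta1 w c e3 * (e3 - eta2 w c e3)) / (e3 * (eta2 w c e3 - eta1 w c e3)).
Definition gfac (w c e3 : R) : R := 2 / sqrt (e3 * (eta2 w c e3 - eta1 w c e3)).
Definition beta2 (w c e3 : R) : R := - e3 * modk2 w c e3 / eta1 w c e3.
Definition Tper (w c e3 : R) : R := 4 * gfac w c e3 * ellK (modk2 w c e3).

(* the unique eta3 in (alpha0, alpha1) with T(eta3) = 2L (for L > L0) *)
Definition eta3L (w c L : R) : R :=
  epsilon (inhabits 0)
    (fun e => alpha0 w c < e < alpha1 w c /\ Tper w c e = 2 * L).

(* Phi^L_{w,c}, given by its (smooth) formula on all of R; the theorem only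
   looks at it on [-L,L]. *)
Definition PhiL (w c L x : R) : R :=
  let e3 := eta3L w c L in
  let k2 := modk2 w c e3 in
  let g := gfac w c e3 in
  sqrt (e3 * (jdn k2 (x / (2 * g)))^2 / (1 + beta2 w c e3 * (jsn k2 (x / (2 * g)))^2)).

Definition Phi (w c x : R) : R :=
  sqrt (if Rlt_dec (c^2 / 4) w then
          (4 * w - c^2) /
          (sqrt w * (cosh (sqrt (4 * w - c^2) * x) - c / (2 * sqrt w)))
        else 4 * c / ((c * x)^2 + 1)).

Definition supnorm (L : R) (f : R -> R) : Rbar :=
  Lub_Rbar (fun y => exists x, -L <= x <= L /\ y = Rabs (f x)).

Fixpoint CmNorm (m : nat) (L : R) (f : R -> R) : Rbar :=
  match m with
  | O => supnorm L f
  | S n => Rbar_plus (CmNorm n L f) (supnorm L (Derive_n f (S n)))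
  end.

(* Main.v *)
Require Import Defs.
From Stdlib Require Import Reals Lra Psatz ClassicalEpsilon.
From Coquelicot Require Import Coquelicot.
Open Scope R_scope.

(** Both families of profiles solve the same autonomous equation
    [y'' = (w - c^2/4) y + (c/2) y^3 - (3/16) y^5] with [y'(0) = 0], and
    [PhiL 0 = sqrt eta3], [Phi 0 = sqrt alpha1].  Since the period [T] is bounded on
    [(alpha0, alpha1 - d]] for every [d > 0], the root of [T = 2 L] is forced towards
    [alpha1] as [L] grows, so the initial data converge; this needs neither the
    monotonicity of [T] nor a distinction between [w > c^2/4] (where [k -> 1]) and
    [w = c^2/4] (where [k^2 -> 1/2] and [g -> oo]).  Gronwall gives closeness in [C^1]
    on a fixed [[0, N]].  On [[N, L]] both functions are small, [PhiL] being decreasing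
    there, and then so are their derivatives by conservation of energy.  Finally every
    higher derivative is one fixed polynomial in [(y, y')], hence Lipschitz in it on
    bounded sets. *)

(** * Autonomous second-order equations *)

(** Polynomials in [u] and [v] are kept as syntax so that differentiation along the flow, bounds and
    Lipschitz constants for every order all come from one structural induction. *)
Inductive pexp : Type :=
| PCst (r : R) | PU | PV | PAdd (p q : pexp) | PMul (p q : pexp).

Fixpoint peval (p : pexp) (u v : R) : R :=
  match p with
  | PCst r => r
  | PU => u
  | PV => v
  | PAdd p q => peval p u v + peval q u v
  | PMul p q => peval p u v * peval q u v
  end.

(* Total derivative along the system u' = v, v' = f(u, v). *)
Fixpoint pder (f p : pexp) : pexp :=
  match p with
  | PCst _ => PCst 0
  | PU => PV
  | PV => f
  | PAdd p q => PAdd (pder f p) (pder f q)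
  | PMul p q => PAdd (PMul (pder f p) q) (PMul p (pder f q))
  end.

Lemma is_derive_peval (f p : pexp) (y y' : R -> R) (x : R) :
  is_derive y x (y' x) ->
  is_derive y' x (peval f (y x) (y' x)) ->
  is_derive (fun t => peval p (y t) (y' t)) x (peval (pder f p) (y x) (y' x)).
Proof.
intros Hy Hy'; induction p as [r| | |p IHp q IHq|p IHp q IHq]; simpl.
- apply @is_derive_const.
- exact Hy.
- exact Hy'.
- now apply @is_derive_plus.
- apply (is_derive_mult _ _ _ _ _ IHp IHq); intros; apply Rmult_comm.
Qed.

Lemma peval_bounded (p : pexp) (B : R) :
  exists M, 0 <= M /\
  forall u v, Rabs u <= B -> Rabs v <= B -> Rabs (peval p u v) <= M.
Proof.
induction p as [r| | |p [M [HM IHp]] q [N [HN IHq]]|p [M [HM IHp]] q [N [HN IHq]]];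
  simpl.
- exists (Rabs r); split; [apply Rabs_pos|]; intros; lra.
(* The sign of [B] is not assumed; the maximum with 0 keeps the bound nonnegative, as the product
   case requires. *)
- exists (Rmax 0 B); split; [apply Rmax_l|]; intros u v Hu Hv.
  apply Rle_trans with (1 := Hu), Rmax_r.
- exists (Rmax 0 B); split; [apply Rmax_l|]; intros u v Hu Hv.
  apply Rle_trans with (1 := Hv), Rmax_r.
- exists (M + N); split; [lra|]; intros u v Hu Hv.
  apply Rle_trans with (1 := Rabs_triang _ _).
  specialize (IHp u v Hu Hv); specialize (IHq u v Hu Hv); lra.
- exists (M * N); split; [now apply Rmult_le_pos|]; intros u v Hu Hv.
  rewrite Rabs_mult; apply Rmult_le_compat; auto using Rabs_pos.
Qed.

Lemma peval_lipschitz (p : pexp) (B : R) :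
  exists K, 0 <= K /\
  forall u v u' v', Rabs u <= B -> Rabs v <= B -> Rabs u' <= B -> Rabs v' <= B ->
  Rabs (peval p u v - peval p u' v') <= K * (Rabs (u - u') + Rabs (v - v')).
Proof.
induction p as [r| | |p [K [HK IHp]] q [J [HJ IHq]]|p [K [HK IHp]] q [J [HJ IHq]]];
  simpl.
- exists 0; split; [lra|]; intros.
  rewrite Rminus_diag, Rabs_R0; lra.
- exists 1; split; [lra|]; intros u v u' v' _ _ _ _.
  generalize (Rabs_pos (v - v')); lra.
- exists 1; split; [lra|]; intros u v u' v' _ _ _ _.
  generalize (Rabs_pos (u - u')); lra.
- exists (K + J); split; [lra|]; intros u v u' v' Hu Hv Hu' Hv'.
  specialize (IHp u v u' v' Hu Hv Hu' Hv'); specialize (IHq u v u' v' Hu Hv Hu' Hv').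
  replace (_ - _) with ((peval p u v - peval p u' v') + (peval q u v - peval q u' v')) by ring.
  apply Rle_trans with (1 := Rabs_triang _ _); lra.
- destruct (peval_bounded p B) as [M [HM Mp]], (peval_bounded q B) as [N [HN Nq]].
  exists (K * N + M * J); split; [nra|]; intros u v u' v' Hu Hv Hu' Hv'.
  specialize (IHp u v u' v' Hu Hv Hu' Hv'); specialize (IHq u v u' v' Hu Hv Hu' Hv').
  replace (_ - _) with ((peval p u v - peval p u' v') * peval q u v
    + peval p u' v' * (peval q u v - peval q u' v')) by ring.
  apply Rle_trans with (1 := Rabs_triang _ _); rewrite 2!Rabs_mult.
  rewrite Rmult_plus_distr_r; apply Rplus_le_compat.
  + replace (K * N * _) with (K * (Rabs (u - u') + Rabs (v - v')) * N) by ring.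
    apply Rmult_le_compat; auto using Rabs_pos.
  + rewrite Rmult_assoc; apply Rmult_le_compat; auto using Rabs_pos.
Qed.

Lemma is_derive_nonpos_le (f df : R -> R) (a b : R) :
  a <= b -> (forall x, is_derive f x (df x)) ->
  (forall x, a <= x <= b -> df x <= 0) -> f b <= f a.
Proof.
intros Hab Hf Hdf.
destruct (MVT_gen f a b df) as [x [Hx E]].
- intros; apply Hf.
- intros x _; apply derivable_continuous_pt.
  exists (df x); now apply is_derive_Reals.
- rewrite Rmin_left, Rmax_right in Hx by assumption.
  specialize (Hdf x Hx); nra.
Qed.

(** Integrating factor: [G t * exp (- K * t)] has a nonpositive derivative. *)
Lemma gronwall (G dG : R -> R) (K x : R) :
  0 <= x -> (forall t, is_derive G t (dG t)) ->
  (forall t, dG t <= K * G t) -> G x <= G 0 * exp (K * x).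
Proof.
intros Hx HG HdG.
assert (D : forall t, is_derive (fun t => G t * exp (- K * t)) t
              ((dG t - K * G t) * exp (- K * t))).
{ intros t; auto_derive; [now exists (dG t)|].
  replace (Derive (fun x0 => G x0) t) with (dG t); [ring|].
  symmetry; now apply is_derive_unique. }
assert (H := is_derive_nonpos_le _ _ 0 x Hx D).
simpl in H.
assert (H1 : G x * exp (- K * x) <= G 0 * exp (- K * 0)).
{ apply H; intros t _; specialize (HdG t).
  generalize (exp_pos (- K * t)); nra. }
rewrite Rmult_0_r, exp_0, Rmult_1_r in H1.
apply Rmult_le_reg_r with (exp (- K * x)); [apply exp_pos|].
rewrite Rmult_assoc, <- exp_plus.
replace (K * x + - K * x) with 0 by ring; rewrite exp_0; lra.
Qed.

(* [nlf] does not involve PV, so its second argument is irrelevant: [profile] puts 0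
   there. *)
Definition nlf (w c : R) : pexp :=
  PAdd (PMul (PCst (w - c^2 / 4)) PU)
    (PAdd (PMul (PCst (c / 2)) (PMul PU (PMul PU PU)))
      (PMul (PCst (- (3 / 16))) (PMul PU (PMul PU (PMul PU (PMul PU PU)))))).

(* Twice the primitive of the nonlinearity, so that y'^2 - pot(y) is conserved. *)
Definition pot (w c u : R) : R := (w - c^2 / 4) * u^2 + c / 4 * u^4 - u^6 / 16.

(** Written as a first-order system with the derivative [y'] as explicit data, which lets closed
    formulas be checked directly. *)
Definition profile (w c : R) (y y' : R -> R) : Prop :=
  (forall x, is_derive y x (y' x)) /\
  (forall x, is_derive y' x (peval (nlf w c) (y x) 0)).

(** Gronwall for the squared distance in the phase plane. The constant depends only on [w], [c] and
    the common bound [B], hence serves all profiles at once. *)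
Lemma profile_stability (w c B : R) :
  exists K, 0 <= K /\ forall y y' z z',
  profile w c y y' -> profile w c z z' ->
  (forall x, Rabs (y x) <= B) -> (forall x, Rabs (z x) <= B) ->
  forall x, 0 <= x ->
  (y x - z x)^2 + (y' x - z' x)^2
  <= ((y 0 - z 0)^2 + (y' 0 - z' 0)^2) * exp (K * x).
Proof.
(* [Rmax 0 B] makes the box contain the dummy second argument 0 of [nlf]. *)
destruct (peval_lipschitz (nlf w c) (Rmax 0 B)) as [K [HK Lip]].
(* With d, e the differences of values and of slopes, the derivative of d^2 + e^2 is at most 2 (1 +
   K) |d| |e|, hence at most (1 + K) (d^2 + e^2). *)
exists (1 + K); split; [lra|].
intros y y' z z' [Hy Hy'] [Hz Hz'] By Bz x Hx.
set (G t := (y t - z t)^2 + (y' t - z' t)^2).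
set (dG t := 2 * (y t - z t) * (y' t - z' t)
  + 2 * (y' t - z' t) * (peval (nlf w c) (y t) 0 - peval (nlf w c) (z t) 0)).
apply (gronwall G dG); [assumption| |].
- intros t; unfold G, dG; auto_derive.
  + repeat split; eexists; auto.
  + rewrite (is_derive_unique (fun x : R => y x) _ _ (Hy t)),
      (is_derive_unique (fun x : R => z x) _ _ (Hz t)).
    rewrite (is_derive_unique (fun x : R => y' x) _ _ (Hy' t)),
      (is_derive_unique (fun x : R => z' x) _ _ (Hz' t)).
    ring.
- intros t; unfold G, dG.
  assert (H : Rabs (peval (nlf w c) (y t) 0 - peval (nlf w c) (z t) 0)
    <= K * Rabs (y t - z t)).
  { assert (B0 : Rabs 0 <= Rmax 0 B) by (rewrite Rabs_R0; apply Rmax_l).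
    assert (Bt : forall v, Rabs v <= B -> Rabs v <= Rmax 0 B)
      by (intros; eapply Rle_trans; eauto using Rmax_r).
    generalize (Lip (y t) 0 (z t) 0 (Bt _ (By t)) B0 (Bt _ (Bz t)) B0).
    now rewrite (Rminus_diag 0), Rabs_R0, Rplus_0_r. }
  set (d := y t - z t) in *; set (e := y' t - z' t) in *.
  set (h := _ - _) in H |- *; clearbody d e h.
  assert (H2 : e * h <= Rabs e * (K * Rabs d)).
  { apply Rle_trans with (1 := Rle_abs _); rewrite Rabs_mult.
    apply Rmult_le_compat_l; auto using Rabs_pos. }
  rewrite <- (pow2_abs d), <- (pow2_abs e) in *.
  assert (H3 : d * e <= Rabs d * Rabs e) by (rewrite <- Rabs_mult; apply Rle_abs).
  set (a := Rabs d) in *; set (b := Rabs e) in *; clearbody a b.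
  assert (0 <= (a - b)^2) by apply pow2_ge_0.
  assert (0 <= K * (a - b)^2) by (apply Rmult_le_pos; trivial).
  nra.
Qed.

(** The reflected pair [y (- t)], [- y' (- t)] solves the same system with the same data at 0, so
    stability with initial distance 0 identifies the two. *)
Lemma profile_even (w c B : R) (y y' : R -> R) :
  profile w c y y' -> (forall x, Rabs (y x) <= B) -> y' 0 = 0 ->
  forall x, 0 <= x -> y (- x) = y x /\ y' (- x) = - y' x.
Proof.
intros [Hy Hy'] By H0 x Hx.
destruct (profile_stability w c B) as [K [_ HK]].
specialize (HK (fun t => y (- t)) (fun t => - y' (- t)) y y').
assert (H := fun a b => HK a b (fun t => By (- t)) By x Hx); simpl in H.
rewrite Ropp_0, H0 in H.
assert (E : (y (- x) - y x)^2 + (- y' (- x) - y' x)^2 <= 0).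
{ replace 0 with (((y 0 - y 0) * ((y 0 - y 0) * 1)
     + (- 0 - 0) * ((- 0 - 0) * 1)) * exp (K * x)) at 1 by ring.
  apply H; [|now split].
  split; intros t.
  - auto_derive; [eexists; apply Hy|].
    rewrite (is_derive_unique (fun x : R => y x) _ _ (Hy (- t))); ring.
  - auto_derive; [eexists; apply Hy'|].
    rewrite (is_derive_unique (fun x : R => y' x) _ _ (Hy' (- t))); ring. }
assert (A := pow2_ge_0 (y (- x) - y x)); assert (C := pow2_ge_0 (- y' (- x) - y' x)).
split; apply Rminus_diag_uniq; apply (Rsqr_eq_0); unfold Rsqr; nra.
Qed.

Lemma profile_energy (w c : R) (y y' : R -> R) (x : R) :
  profile w c y y' -> y' 0 = 0 -> 0 <= x ->
  (y' x)^2 = pot w c (y x) - pot w c (y 0).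
Proof.
intros [Hy Hy'] H0 Hx.
set (H t := (y' t)^2 - pot w c (y t)).
assert (D : forall t, is_derive H t 0).
{ intros t; unfold H, pot; auto_derive.
  - repeat split; eexists; auto.
  - rewrite (is_derive_unique (fun x : R => y x) _ _ (Hy t)),
      (is_derive_unique (fun x : R => y' x) _ _ (Hy' t)).
    simpl; field. }
assert (E : H x = H 0).
{ apply Rle_antisym.
  - apply (is_derive_nonpos_le H (fun _ => 0)); auto; intros; lra.
  - apply Ropp_le_cancel.
    apply (is_derive_nonpos_le (fun t => - H t) (fun _ => - 0)); auto; [|intros; lra].
    intros t; apply @is_derive_opp, D. }
unfold H in E; rewrite H0 in E; lra.
Qed.
(** Drop the sextic term and use u^4 <= B^2 u^2. Through the energy identity, a small value then
    forces a small slope. *)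
Lemma pot_le_sqr (w c B u : R) :
  0 <= u <= B -> pot w c u <= (Rabs (w - c^2 / 4) + Rabs c / 4 * B^2) * u^2.
Proof.
intros Hu; unfold pot.
assert (H1 := Rle_abs (w - c^2 / 4)); assert (H2 := Rle_abs c).
set (a := w - c^2 / 4) in *; clearbody a.
set (b := Rabs c) in *; assert (Hb : 0 <= b) by apply Rabs_pos; clearbody b.
assert (0 <= u^2) by apply pow2_ge_0; assert (u^2 <= B^2) by (apply pow_incr; lra).
assert (0 <= u^2 * u^2) by nra.
assert (0 <= u^6) by (apply pow_le; lra).
assert (a * u^2 <= Rabs a * u^2) by nra.
assert (c * (u^2 * u^2) <= b * (u^2 * u^2)) by nra.
assert (b * u^2 * u^2 <= b * B^2 * u^2).
{ apply Rmult_le_compat_r; trivial; apply Rmult_le_compat_l; trivial. }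
replace (u^4) with (u^2 * u^2) by ring; lra.
Qed.

Lemma pot_continuity (w c u : R) : continuity_pt (pot w c) u.
Proof.
apply derivable_continuous_pt, ex_derive_Reals_0; unfold pot; auto_derive; trivial.
Qed.

(** * Closeness of monotone profiles to a homoclinic one *)

Definition homoclinic (w c B : R) (z z' : R -> R) : Prop :=
  profile w c z z' /\ (forall x, 0 <= z x <= B) /\ z' 0 = 0 /\
  pot w c (z 0) = 0 /\
  (forall eta, 0 < eta -> exists N, 0 <= N /\ forall x, N <= x -> z x <= eta).

(** Where a homoclinic profile has energy 0 and decays, a nearby one is only asked to be
    nonincreasing on [0, L]: monotonicity carries smallness at one point [N] over to all of
    [N, L]. *)
Definition near_profile (w c B : R) (z : R -> R) (d L : R) (y y' : R -> R) : Prop :=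
  profile w c y y' /\ (forall x, 0 <= y x <= B) /\ y' 0 = 0 /\
  Rabs (y 0 - z 0) <= d /\
  (forall a b, 0 <= a -> a <= b -> b <= L -> y b <= y a).

(** The point is that [d] is chosen before [L]: Gronwall is applied only on [0, N], with [N]
    determined by the decay of [z], and energy takes over beyond [N]. *)
Lemma near_profile_close (w c B : R) (z z' : R -> R) (eps : R) :
  homoclinic w c B z z' -> 0 < eps ->
  exists d, 0 < d /\ forall L y y', near_profile w c B z d L y y' ->
  forall x, - L <= x <= L ->
  Rabs (y x - z x) <= eps /\ Rabs (y' x - z' x) <= eps.
Proof.
intros (Pz & Bz & z0 & Ez & Tz) Heps.
assert (Babs : forall f, (forall x : R, 0 <= f x <= B) -> forall x, Rabs (f x) <= B).
{ intros f Hf x; specialize (Hf x); rewrite Rabs_pos_eq; lra. }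
assert (Hpot := pot_le_sqr w c B).
set (K := Rabs (w - c^2 / 4) + Rabs c / 4 * B^2) in Hpot.
assert (HK : 0 <= K).
{ apply Rplus_le_le_0_compat; [apply Rabs_pos|].
  apply Rmult_le_pos; [|apply pow2_ge_0].
  generalize (Rabs_pos c); lra. }
clearbody K.
(* The factor 5 (1 + K) yields both 2 eta <= eps, for the values, and 10 K eta^2 <= eps^2 / 2, for
   the slopes on the tail. *)
set (eta := eps / (5 * (1 + K))).
assert (Heta : 0 < eta) by (apply Rdiv_lt_0_compat; lra).
assert (Heta1 : 5 * eta + 5 * (K * eta) = eps) by (unfold eta; field; lra).
assert (HKeta : 0 <= K * eta) by (apply Rmult_le_pos; lra).
assert (Heta2 : 2 * eta <= eps) by lra.
assert (Heta3 : 10 * K * eta^2 <= eps^2 / 2) by (clearbody eta; subst eps; nra).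
destruct (Tz eta Heta) as (N & HN & TN).
destruct (profile_stability w c B) as (J & HJ & Stab).
assert (HE : 1 <= exp (J * N)).
{ rewrite <- exp_0.
  destruct (Rle_lt_or_eq_dec 0 (J * N)) as [H|H]; [now apply Rmult_le_pos| |].
  - left; now apply exp_increasing.
  - rewrite H; lra. }
(* The energy of [y] is [- pot w c (y 0)] and that of [z] is 0; continuity of [pot] makes the former
   at most eps^2 / 4. *)
destruct (pot_continuity w c (z 0) (eps^2 / 4)) as (d1 & Hd1 & Hc);
  [apply Rdiv_lt_0_compat; [now apply pow_lt|lra]|].
set (E := exp (J * N)) in *.
(* An initial gap of at most [d2] grows, by the factor [E] on the squares, to at most eta^2 at time
   [N]. *)
set (d2 := eta / E).
assert (Hd2 : 0 < d2) by (apply Rdiv_lt_0_compat; lra).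
assert (Hd2E : d2^2 * E <= eta^2).
{ replace eta with (d2 * E) by (unfold d2; field; lra).
  replace ((d2 * E)^2) with (d2^2 * E * E) by ring.
  assert (0 <= d2^2 * E) by (apply Rmult_le_pos; [apply pow2_ge_0|lra]); nra. }
(* Half of [d1], because continuity asks for a strict inequality. *)
exists (Rmin (d1 / 2) d2); split; [apply Rmin_pos; lra|].
intros L y y' (Py & By & y0 & Dy & My).
assert (Dy1 := Rle_trans _ _ _ Dy (Rmin_l _ _)).
assert (Dy2 := Rle_trans _ _ _ Dy (Rmin_r _ _)).
assert (Hpy : - pot w c (y 0) <= eps^2 / 4).
(* [continuity_pt] speaks only of points different from the base point. *)
{ destruct (Req_dec (y 0) (z 0)) as [H|H].
  - rewrite H, Ez; generalize (pow2_ge_0 eps); lra.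
  - assert (H1 : Rabs (pot w c (y 0) - pot w c (z 0)) < eps^2 / 4).
    { apply Hc; split; [split; [exact I|congruence]|].
      simpl; unfold Rdist; lra. }
    rewrite Ez, Rminus_0_r in H1; apply Rabs_def2 in H1; lra. }
assert (Near : forall x, 0 <= x <= N ->
  Rabs (y x - z x) <= eta /\ Rabs (y' x - z' x) <= eta).
{ intros x Hx.
  assert (S := Stab y y' z z' Py Pz (Babs _ By) (Babs _ Bz) x (proj1 Hx)).
  rewrite y0, z0 in S.
  assert (Hexp : exp (J * x) <= E).
  { destruct (Rle_lt_or_eq_dec (J * x) (J * N)) as [H|H];
      [apply Rmult_le_compat_l; lra| |].
    - left; now apply exp_increasing.
    - rewrite H; apply Rle_refl. }
  assert (H0 : (y 0 - z 0)^2 <= d2^2).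
  { rewrite <- pow2_abs; apply pow_incr; split; auto using Rabs_pos. }
  assert (S2 : ((y 0 - z 0)^2 + (0 - 0)^2) * exp (J * x) <= eta^2).
  { apply Rle_trans with (2 := Hd2E); rewrite Rminus_diag.
    replace ((y 0 - z 0)^2 + 0^2) with ((y 0 - z 0)^2) by ring.
    apply Rmult_le_compat; auto using pow2_ge_0; left; apply exp_pos. }
  assert (A := pow2_ge_0 (y x - z x)); assert (C := pow2_ge_0 (y' x - z' x)).
  split; rewrite <- (Rabs_pos_eq eta) by lra;
    apply Rsqr_le_abs_0; unfold Rsqr; nra. }
assert (Pos : forall x, 0 <= x <= L ->
  Rabs (y x - z x) <= eps /\ Rabs (y' x - z' x) <= eps).
{ intros x Hx; destruct (Rle_lt_dec x N) as [HxN|HxN].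
  { destruct (Near x); [lra|]; split; lra. }
  destruct (Near N) as [HyN _]; [lra|].
  assert (HzN := TN N (Rle_refl _)); assert (Hzx := TN x (Rlt_le _ _ HxN)).
  (* Beyond [N]: y x <= y N <= z N + eta <= 2 eta, while z x <= eta. *)
  assert (HyxN : y x <= y N) by (apply My; lra).
  assert (H := Rle_abs (y N - z N)).
  assert (Byx := By x); assert (Bzx := Bz x).
  split; [apply Rabs_le; lra|].
  assert (Ey := profile_energy w c y y' x Py y0 (proj1 Hx)).
  assert (Ez' := profile_energy w c z z' x Pz z0 (proj1 Hx)).
  rewrite Ez, Rminus_0_r in Ez'.
  assert (Py2 := Hpot _ Byx); assert (Pz2 := Hpot _ Bzx).
  assert (y x ^ 2 <= 4 * eta^2).
  { replace (4 * eta^2) with ((2 * eta)^2) by ring; apply pow_incr; lra. }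
  assert (z x ^ 2 <= eta^2) by (apply pow_incr; lra).
  assert (K * y x ^ 2 <= K * (4 * eta^2)) by (apply Rmult_le_compat_l; trivial).
  assert (K * z x ^ 2 <= K * eta^2) by (apply Rmult_le_compat_l; trivial).
  (* (y' - z')^2 <= 2 y'^2 + 2 z'^2, where y'^2 <= 4 K eta^2 + eps^2 / 4 and z'^2 <= K eta^2; the
     total is 10 K eta^2 + eps^2 / 2 <= eps^2. *)
  assert (A := pow2_ge_0 (y' x + z' x)).
  rewrite <- (Rabs_pos_eq eps) by lra.
  apply Rsqr_le_abs_0; unfold Rsqr; nra. }
intros x Hx; destruct (Rle_lt_dec 0 x) as [H0|H0]; [apply Pos; lra|].
destruct (profile_even w c B y y' Py (Babs _ By) y0 (- x)) as [Ey Ey']; [lra|].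
destruct (profile_even w c B z z' Pz (Babs _ Bz) z0 (- x)) as [Fz Fz']; [lra|].
rewrite Ropp_involutive in *.
destruct (Pos (- x)) as [H1 H2]; [lra|].
rewrite Ey, Ey', Fz, Fz'; split; trivial.
replace (- y' (- x) - - z' (- x)) with (- (y' (- x) - z' (- x))) by ring.
now rewrite Rabs_Ropp.
Qed.

(** * Higher derivatives and the [CmNorm] bound *)

Definition jet (w c : R) (n : nat) : pexp := Nat.iter n (pder (nlf w c)) PU.

Lemma Derive_n_profile_sub (w c : R) (y y' z z' : R -> R) (n : nat) (x : R) :
  profile w c y y' -> profile w c z z' ->
  Derive_n (fun t => y t - z t) n x =
  peval (jet w c n) (y x) (y' x) - peval (jet w c n) (z x) (z' x).
Proof.
intros [Hy Hy'] [Hz Hz']; revert x; induction n as [|n IH]; intros x; [reflexivity|].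
simpl; rewrite (Derive_ext _ _ _ IH).
apply is_derive_unique, @is_derive_minus; apply is_derive_peval; auto.
Qed.

Lemma supnorm_le (L : R) (f : R -> R) (e : R) :
  (forall x, - L <= x <= L -> Rabs (f x) <= e) -> Rbar_le (supnorm L f) e.
Proof.
intros H; unfold supnorm.
apply (proj2 (Lub_Rbar_correct _)).
intros y (x & Hx & ->); now apply H.
Qed.

Lemma homoclinic_derivative_bounded (w c B : R) (z z' : R -> R) :
  homoclinic w c B z z' -> exists M, forall x, Rabs (z' x) <= M.
Proof.
intros (Pz & Bz & z0 & Ez & _).
set (K := Rabs (w - c^2 / 4) + Rabs c / 4 * B^2).
(* From z'^2 <= s with s >= 0 follows |z'| <= 1 + s, since s <= (1 + s)^2. *)
exists (1 + Rabs (K * B^2)).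
assert (H : forall x, 0 <= x -> Rabs (z' x) <= 1 + Rabs (K * B^2)).
{ intros x Hx.
  assert (E := profile_energy w c z z' x Pz z0 Hx).
  assert (H1 := pot_le_sqr w c B _ (Bz x)); fold K in H1.
  assert (K * (z x)^2 <= Rabs (K * B^2)).
  { apply Rle_trans with (1 := Rle_abs _); rewrite 2!Rabs_mult.
    apply Rmult_le_compat_l; [apply Rabs_pos|].
    rewrite 2!Rabs_pos_eq by apply pow2_ge_0; apply pow_incr, Bz. }
  assert (P := Rabs_pos (K * B^2)).
  rewrite <- (Rabs_pos_eq (1 + _)) by lra.
  apply Rsqr_le_abs_0; unfold Rsqr; nra. }
intros x; destruct (Rle_lt_dec 0 x) as [H0|H0]; [now apply H|].
destruct (profile_even w c B z z' Pz) with (x := - x) as [_ E]; [|trivial|lra|].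
{ intros t; rewrite Rabs_pos_eq; apply Bz. }
rewrite Ropp_involutive in E; rewrite E, Rabs_Ropp; apply H; lra.
Qed.

Lemma near_profile_Derive_n_close (w c B : R) (z z' : R -> R) (n : nat) (eps : R) :
  homoclinic w c B z z' -> 0 < eps ->
  exists d, 0 < d /\ forall L y y', near_profile w c B z d L y y' ->
  forall x, - L <= x <= L ->
  Rabs (Derive_n (fun t => y t - z t) n x) <= eps.
Proof.
intros Hz Heps.
destruct (homoclinic_derivative_bounded _ _ _ _ _ Hz) as [M HM].
destruct (peval_lipschitz (jet w c n) (Rmax B (M + 1))) as (K & HK & Lip).
(* The bound 1 keeps [y'] inside the box of size M + 1 on which [K] is valid; the other one gives 2
   K e <= eps. *)
set (e := Rmin 1 (eps / (2 * K + 1))).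
assert (He : 0 < e) by (apply Rmin_pos; [lra|apply Rdiv_lt_0_compat; lra]).
assert (He1 : e <= 1) by apply Rmin_l.
assert (HKe : K * (2 * e) <= eps).
{ apply Rle_trans with ((2 * K + 1) * e); [lra|].
  apply Rle_trans with ((2 * K + 1) * (eps / (2 * K + 1))).
  - apply Rmult_le_compat_l; [lra|apply Rmin_r].
  - right; field; lra. }
destruct (near_profile_close w c B z z' e Hz He) as (d & Hd & Close).
exists d; split; [exact Hd|]; intros L y y' Hy x Hx.
destruct (Close L y y' Hy x Hx) as [C1 C2].
destruct Hz as (Pz & Bz & _), Hy as (Py & By & _).
rewrite (Derive_n_profile_sub w c y y' z z' n x Py Pz).
assert (Bx := By x); assert (Bx' := Bz x); assert (HMx := HM x).
assert (R1 := Rmax_l B (M + 1)); assert (R2 := Rmax_r B (M + 1)).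
apply Rle_trans with (2 := HKe).
apply Rle_trans with (K * (Rabs (y x - z x) + Rabs (y' x - z' x))).
- apply Lip.
  + rewrite Rabs_pos_eq; lra.
  + replace (y' x) with ((y' x - z' x) + z' x) by ring.
    apply Rle_trans with (1 := Rabs_triang _ _); lra.
  + rewrite Rabs_pos_eq; lra.
  + lra.
- apply Rmult_le_compat_l; lra.
Qed.

Lemma near_profile_CmNorm (w c B : R) (z z' : R -> R) (m : nat) :
  homoclinic w c B z z' -> forall eps, 0 < eps ->
  exists d, 0 < d /\ forall L y y', near_profile w c B z d L y y' ->
  Rbar_le (CmNorm m L (fun x => y x - z x)) eps.
Proof.
intros Hz; induction m as [|m IH]; intros eps Heps.
- destruct (near_profile_Derive_n_close w c B z z' 0 eps Hz Heps) as (d & Hd & H).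
  exists d; split; [exact Hd|]; intros L y y' Hy.
  apply supnorm_le, (H L y y' Hy).
- destruct (IH (eps / 2)) as (d1 & Hd1 & H1); [lra|].
  destruct (near_profile_Derive_n_close w c B z z' (S m) (eps / 2) Hz) as (d2 & Hd2 & H2);
    [lra|].
  exists (Rmin d1 d2); split; [now apply Rmin_pos|]; intros L y y' Hy.
  assert (Weaken : forall d, Rmin d1 d2 <= d -> near_profile w c B z d L y y').
  { intros d Hd; destruct Hy as (Py & By & y0 & Dy & My).
    split; [exact Py|split; [exact By|split; [exact y0|split; [|exact My]]]]; lra. }
  replace (Finite eps) with (Rbar_plus (eps / 2) (eps / 2)) by (simpl; f_equal; field).
  apply Rbar_plus_le_compat.
  + apply (H1 L y y'), Weaken, Rmin_l.
  + apply supnorm_le, (H2 L y y'), Weaken, Rmin_r.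
Qed.

(** * Jacobi elliptic functions *)

Lemma sin_sqr_bounds (x : R) : 0 <= (sin x)^2 <= 1.
Proof.
generalize (sin2_cos2 x); unfold Rsqr.
generalize (pow2_ge_0 (sin x)) (pow2_ge_0 (cos x)); nra.
Qed.

Section Amplitude.

(** [k] stands for the squared modulus. *)
Context (k : R) (Hk : 0 <= k < 1).

Lemma ell_radicand_bounds (x : R) : 1 - k <= 1 - k * (sin x)^2 <= 1.
Proof. generalize (sin_sqr_bounds x); nra. Qed.

Lemma ell_integrand_continuous (x : R) :
  continuous (fun t => / sqrt (1 - k * (sin t)^2)) x.
Proof.
apply (ex_derive_continuous (V := R_NormedModule)); generalize (ell_radicand_bounds x); intros H.
auto_derive; repeat split; simpl in H; try lra.
apply Rgt_not_eq, sqrt_lt_R0; lra.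
Qed.

Lemma ellF_is_derive (x : R) : is_derive (ellF k) x (/ sqrt (1 - k * (sin x)^2)).
Proof.
apply (is_derive_RInt (fun t => / sqrt (1 - k * (sin t)^2)) _ 0); [|apply ell_integrand_continuous].
apply filter_forall; intros y; apply @RInt_correct, @ex_RInt_continuous.
intros; apply ell_integrand_continuous.
Qed.

Lemma ell_integrand_ge_1 (x : R) : 1 <= / sqrt (1 - k * (sin x)^2).
Proof.
destruct (ell_radicand_bounds x) as [H1 H2].
rewrite <- Rinv_1 at 1; apply Rinv_le_contravar; [apply sqrt_lt_R0; lra|].
rewrite <- sqrt_1 at 2; now apply sqrt_le_1_alt.
Qed.

Lemma ellF_sub (a b : R) : exists xi, Rmin a b <= xi <= Rmax a b /\
  ellF k b - ellF k a = / sqrt (1 - k * (sin xi)^2) * (b - a).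
Proof.
apply (MVT_gen (ellF k) a b (fun x => / sqrt (1 - k * (sin x)^2))).
- intros; apply ellF_is_derive.
- intros x _; apply derivable_continuous_pt.
  eexists; apply is_derive_Reals, ellF_is_derive.
Qed.

Lemma ellF_0 : ellF k 0 = 0.
Proof. apply (RInt_point (V := R_CompleteNormedModule)). Qed.

(** The integrand is at least 1. This one inequality makes [ellF k] injective and onto, so that
    [jam] is a true inverse, and makes [jam] 1-Lipschitz. *)
Lemma ellF_expansive (a b : R) : a <= b -> b - a <= ellF k b - ellF k a.
Proof.
intros Hab; destruct (ellF_sub a b) as (xi & _ & E); rewrite E.
generalize (ell_integrand_ge_1 xi); nra.
Qed.

Lemma ellF_le_inv (a b : R) : ellF k a <= ellF k b -> a <= b.
Proof.
intros H; destruct (Rle_lt_dec a b) as [|Hab]; [assumption|].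
generalize (ellF_expansive b a (Rlt_le _ _ Hab)); lra.
Qed.

Lemma ellF_surjective (u : R) : exists x, ellF k x = u.
Proof.
assert (H0 := ellF_0).
assert (H1 := ellF_expansive (- Rabs u) 0); assert (H2 := ellF_expansive 0 (Rabs u)).
assert (P := Rabs_pos u); assert (Q := Rle_abs u).
assert (Q' := Rle_abs (- u)); rewrite Rabs_Ropp in Q'.
destruct (IVT_gen (ellF k) (- Rabs u) (Rabs u) u) as (x & _ & E).
- intros x; apply derivable_continuous_pt.
  eexists; apply is_derive_Reals, ellF_is_derive.
- split; [apply Rle_trans with (1 := Rmin_l _ _)|apply Rle_trans with (2 := Rmax_r _ _)];
    lra.
- now exists x.
Qed.

Lemma ellF_jam (u : R) : ellF k (jam k u) = u.
Proof.
unfold jam; apply epsilon_spec, ellF_surjective.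
Qed.

Lemma jam_ellF (x : R) : jam k (ellF k x) = x.
Proof.
apply Rle_antisym; apply ellF_le_inv; rewrite ellF_jam; apply Rle_refl.
Qed.

Lemma jam_monotone (u v : R) : u <= v -> jam k u <= jam k v.
Proof. intros H; apply ellF_le_inv; now rewrite 2!ellF_jam. Qed.

Lemma jam_lipschitz (u v : R) : Rabs (jam k u - jam k v) <= Rabs (u - v).
Proof.
assert (H : forall u v, u <= v -> Rabs (jam k u - jam k v) <= Rabs (u - v)).
{ clear u v; intros u v Huv; assert (H := jam_monotone u v Huv).
  assert (E := ellF_expansive _ _ H); rewrite 2!ellF_jam in E.
  rewrite 2!Rabs_left1; lra. }
destruct (Rle_lt_dec u v); [now apply H|].
rewrite Rabs_minus_sym, (Rabs_minus_sym u); apply H; lra.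
Qed.

(** Inverse function rule: by the mean value theorem for [ellF], the difference quotient of [jam] is
    sqrt (1 - k sin^2 xi) with [xi] between the two amplitudes. *)
Lemma jam_is_derive (u : R) : is_derive (jam k) u (jdn k u).
Proof.
apply is_derive_Reals; intros eps Heps.
assert (C : continuity_pt (fun x => sqrt (1 - k * (sin x)^2)) (jam k u)).
{ apply derivable_continuous_pt, ex_derive_Reals_0.
  assert (H := ell_radicand_bounds (jam k u)); simpl in H.
  auto_derive; repeat split; lra. }
destruct (C eps Heps) as (d & Hd & Hc).
exists (mkposreal d Hd); intros h Hh Hhd; simpl in Hhd.
destruct (ellF_sub (jam k u) (jam k (u + h))) as (xi & Hxi & E).
rewrite 2!ellF_jam in E.
assert (Q : (jam k (u + h) - jam k u) / h = sqrt (1 - k * (sin xi)^2)).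
{ assert (S : 0 < sqrt (1 - k * (sin xi)^2)).
  { apply sqrt_lt_R0; generalize (ell_radicand_bounds xi); lra. }
  replace (u + h - u) with h in E by ring.
  assert (jam k (u + h) - jam k u = h * sqrt (1 - k * (sin xi)^2)) as ->.
  { rewrite E at 2; field; lra. }
  field; lra. }
rewrite Q; unfold jdn, jsn.
(* Since [jam] is 1-Lipschitz, [xi] lies within |h| of [jam k u]. *)
assert (N : Rabs (xi - jam k u) < d).
{ apply Rle_lt_trans with (2 := Hhd).
  assert (L := jam_lipschitz (u + h) u); replace (u + h - u) with h in L by ring.
  apply Rle_trans with (2 := L).
  unfold Rmin, Rmax in Hxi; destruct (Rle_dec (jam k u) (jam k (u + h))).
  - rewrite 2!Rabs_pos_eq; lra.
  - rewrite 2!Rabs_left1; lra. }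
destruct (Req_dec (jam k u) xi) as [->|Hne].
- rewrite Rminus_diag, Rabs_R0; lra.
- apply Hc; split; [split; [exact I|exact Hne]|exact N].
Qed.

Lemma jdn_pos (u : R) : 0 < jdn k u.
Proof.
apply sqrt_lt_R0; generalize (ell_radicand_bounds (jam k u)); unfold jsn; lra.
Qed.

Lemma jdn_sqr (u : R) : (jdn k u)^2 = 1 - k * (jsn k u)^2.
Proof.
apply pow2_sqrt; generalize (ell_radicand_bounds (jam k u)); unfold jsn; lra.
Qed.

Definition jcn (u : R) : R := cos (jam k u).

Lemma jcn_sqr (u : R) : (jcn u)^2 = 1 - (jsn k u)^2.
Proof. unfold jcn, jsn; generalize (sin2_cos2 (jam k u)); unfold Rsqr; nra. Qed.

Lemma jsn_is_derive (u : R) : is_derive (jsn k) u (jcn u * jdn k u).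
Proof.
rewrite Rmult_comm; apply (is_derive_comp sin (jam k)).
- apply is_derive_Reals, derivable_pt_lim_sin.
- apply jam_is_derive.
Qed.

Lemma jcn_is_derive (u : R) : is_derive jcn u (- jsn k u * jdn k u).
Proof.
rewrite Rmult_comm; apply (is_derive_comp cos (jam k)).
- apply is_derive_Reals, derivable_pt_lim_cos.
- apply jam_is_derive.
Qed.

Lemma jdn_is_derive (u : R) : is_derive (jdn k) u (- k * jsn k u * jcn u).
Proof.
assert (P := jdn_pos u).
assert (D : is_derive (fun u => sqrt (1 - k * (jsn k u)^2)) u
  (- k * (2 * jsn k u * (jcn u * jdn k u)) / (2 * sqrt (1 - k * (jsn k u)^2)))).
{ assert (J := jsn_is_derive u); auto_derive.
  - split; [eexists; exact J|]; split; [|trivial].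
    generalize (ell_radicand_bounds (jam k u)); unfold jsn; simpl; lra.
  - rewrite (is_derive_unique (fun x : R => jsn k x) _ _ J).
    replace (1 + - (k * (jsn k u * (jsn k u * 1)))) with (1 - k * (jsn k u)^2) by ring.
    field; unfold jdn in P; lra. }
replace (- k * jsn k u * jcn u) with
  (- k * (2 * jsn k u * (jcn u * jdn k u)) / (2 * sqrt (1 - k * (jsn k u)^2)));
  [exact D|].
fold (jdn k u); field; lra.
Qed.

Lemma jam_quarter_period (u : R) : 0 <= u <= ellK k -> 0 <= jam k u <= PI / 2.
Proof.
intros Hu; split.
- rewrite <- (jam_ellF 0), ellF_0; now apply jam_monotone.
- rewrite <- (jam_ellF (PI / 2)); now apply jam_monotone.
Qed.

Lemma jsn_0 : jsn k 0 = 0.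
Proof. unfold jsn; rewrite <- ellF_0 at 1; rewrite jam_ellF; apply sin_0. Qed.

Lemma jsn_incr (u v : R) : 0 <= u -> u <= v -> v <= ellK k ->
  0 <= jsn k u <= jsn k v.
Proof.
intros Hu Huv Hv; unfold jsn.
assert (Ju := jam_quarter_period u); assert (Jv := jam_quarter_period v).
assert (P := PI_RGT_0); split; [apply sin_ge_0; lra|].
apply sin_incr_1; try lra; now apply jam_monotone.
Qed.

End Amplitude.

(** * The elliptic profiles *)

(** Stated for abstract functions in the roles of sn, cn, dn and the root of the denominator, so
    that it is plain algebra. The first formula is short because k (1 + b S^2) + b (1 - k S^2) = k +
    b. *)
Lemma elliptic_profile_derives (S C D r : R -> R) (q k b x : R) :
  is_derive S x (q * (C x * D x)) ->
  is_derive C x (q * (- S x * D x)) ->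
  is_derive D x (q * (- k * S x * C x)) ->
  is_derive r x (q * (b * S x * C x * D x) / r x) ->
  (C x)^2 = 1 - (S x)^2 -> (D x)^2 = 1 - k * (S x)^2 -> (r x)^2 = 1 + b * (S x)^2 ->
  0 < r x ->
  is_derive (fun t => D t / r t) x (- (q * (k + b)) * (S x * C x / (r x)^3)) /\
  is_derive (fun t => S t * C t / (r t)^3) x
    (q * D x * ((1 - 2 * (S x)^2) * (1 + b * (S x)^2)
                - 3 * b * (S x)^2 * (1 - (S x)^2)) / (r x)^5).
Proof.
intros dS dC dD dR EC ED ER HR.
split; auto_derive.
- repeat split; try (eexists; eassumption); lra.
- rewrite (is_derive_unique (fun t : R => D t) _ _ dD).
  rewrite (is_derive_unique (fun t : R => r t) _ _ dR).
  transitivity (q * S x * C x * (- k * (r x)^2 - b * (D x)^2) / (r x)^3); [field; lra|].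
  rewrite ED, ER; field; lra.
- repeat split; try (eexists; eassumption).
  apply Rgt_not_eq; repeat apply Rmult_lt_0_compat; lra.
- rewrite (is_derive_unique (fun t : R => S t) _ _ dS).
  rewrite (is_derive_unique (fun t : R => C t) _ _ dC).
  rewrite (is_derive_unique (fun t : R => r t) _ _ dR).
  transitivity (q * D x * (((C x)^2 - (S x)^2) * (r x)^2 - 3 * b * (S x)^2 * (C x)^2)
    / (r x)^5); [field; lra|].
  rewrite EC, ER; field; lra.
Qed.

Section EllipticProfile.

Context (n1 n2 n3 : R) (Hn : n1 < 0 /\ 0 < n2 /\ n2 < n3).

(** [k], [b], [g] are [modk2], [beta2], [gfac] with the three roots as free parameters, and are
    convertible to them at [eta1], [eta2], [e3]. *)
Let k : R := - n1 * (n3 - n2) / (n3 * (n2 - n1)).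
Let b : R := - n3 * k / n1.
Let g : R := 2 / sqrt (n3 * (n2 - n1)).

Lemma elliptic_modulus_bounds : 0 <= k < 1.
Proof.
assert (0 < n3 * (n2 - n1)) by (apply Rmult_lt_0_compat; lra).
split.
- left; apply Rdiv_lt_0_compat; trivial; apply Rmult_lt_0_compat; lra.
- apply Rmult_lt_reg_r with (n3 * (n2 - n1)); trivial.
  (* Denominator minus numerator is n2 (n3 - n1) > 0. *)
  unfold k; replace (_ / _ * _) with (- n1 * (n3 - n2)) by (field; lra); nra.
Qed.

Let bE : b = (n3 - n2) / (n2 - n1).
Proof. unfold b, k; field; lra. Qed.

Let b_pos : 0 < b.
Proof. rewrite bE; apply Rdiv_lt_0_compat; lra. Qed.

Let g_pos : 0 < g.
Proof.
apply Rdiv_lt_0_compat; [lra|].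
apply sqrt_lt_R0, Rmult_lt_0_compat; lra.
Qed.

Let g_sqr : (/ (2 * g))^2 = n3 * (n2 - n1) / 16.
Proof.
assert (0 < n3 * (n2 - n1)) by (apply Rmult_lt_0_compat; lra).
assert (0 < sqrt (n3 * (n2 - n1))) by now apply sqrt_lt_R0.
unfold g; replace ((/ _)^2) with ((sqrt (n3 * (n2 - n1)))^2 / 16) by (field; lra).
now rewrite pow2_sqrt by lra.
Qed.

Definition elliptic_profile (x : R) : R :=
  sqrt (n3 * (jdn k (x / (2 * g)))^2 / (1 + b * (jsn k (x / (2 * g)))^2)).

Definition elliptic_profile' (x : R) : R :=
  - sqrt n3 * / (2 * g) * (k + b) * (jsn k (x / (2 * g)) * jcn k (x / (2 * g))
    / (sqrt (1 + b * (jsn k (x / (2 * g)))^2))^3).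

Let denom_ge_1 (s : R) : 1 <= 1 + b * s^2.
Proof.
assert (0 <= b * s^2) by (apply Rmult_le_pos; [lra|apply pow2_ge_0]); lra.
Qed.

Lemma elliptic_profileE (x : R) : elliptic_profile x =
  sqrt n3 * (jdn k (x / (2 * g)) / sqrt (1 + b * (jsn k (x / (2 * g)))^2)).
Proof.
unfold elliptic_profile.
assert (Hk := elliptic_modulus_bounds).
assert (HD := jdn_pos k Hk (x / (2 * g))); assert (HR := denom_ge_1 (jsn k (x / (2 * g)))).
rewrite sqrt_div_alt by lra; rewrite sqrt_mult_alt by lra.
rewrite sqrt_pow2 by lra; unfold Rdiv; ring.
Qed.

(** The hypotheses are Vieta's relations: in s = u^2, -16 [pot] is s^3 - 4 c s^2 + (4 c^2 - 16 w) s,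
    and n1, n2, n3 are the roots of this cubic shifted by a constant fixing the energy level. *)
Lemma elliptic_profile_ode (w c : R) :
  4 * c = n1 + n2 + n3 -> 4 * c^2 - 16 * w = n1 * n2 + n1 * n3 + n2 * n3 ->
  profile w c elliptic_profile elliptic_profile'.
Proof.
intros Hc Hw.
assert (Hk := elliptic_modulus_bounds).
set (S x := jsn k (x / (2 * g))); set (C x := jcn k (x / (2 * g))).
set (D x := jdn k (x / (2 * g))); set (r x := sqrt (1 + b * (S x)^2)).
set (q := / (2 * g)).
assert (dq : forall x, is_derive (fun t : R => t / (2 * g)) x q).
{ intros x; auto_derive; trivial; unfold q; field; lra. }
assert (HR : forall x, 0 < r x).
{ intros x; apply sqrt_lt_R0; generalize (denom_ge_1 (S x)); lra. }
assert (R2 : forall x, (r x)^2 = 1 + b * (S x)^2).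
{ intros x; apply pow2_sqrt; generalize (denom_ge_1 (S x)); lra. }
assert (dS : forall x, is_derive S x (q * (C x * D x))).
{ intros x; apply (is_derive_comp (jsn k)); [now apply jsn_is_derive|apply dq]. }
assert (dC : forall x, is_derive C x (q * (- S x * D x))).
{ intros x; apply (is_derive_comp (jcn k)); [now apply jcn_is_derive|apply dq]. }
assert (dD : forall x, is_derive D x (q * (- k * S x * C x))).
{ intros x; apply (is_derive_comp (jdn k)); [now apply jdn_is_derive|apply dq]. }
assert (dR : forall x, is_derive r x (q * (b * S x * C x * D x) / r x)).
{ intros x; unfold r at 1; auto_derive.
  - split; [eexists; apply dS|]; split; [|trivial].
    generalize (denom_ge_1 (S x)); simpl; lra.
  - rewrite (is_derive_unique (fun t : R => S t) _ _ (dS x)).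
    replace (1 + b * (S x * (S x * 1))) with (1 + b * (S x)^2) by ring.
    fold (r x); field; generalize (HR x); lra. }
assert (Both := fun x => elliptic_profile_derives S C D r q k b x (dS x) (dC x) (dD x)
  (dR x) (jcn_sqr k _) (jdn_sqr k Hk _) (R2 x) (HR x)).
split; intros x; destruct (Both x) as [d1 d2].
- apply (is_derive_ext (fun t => sqrt n3 * (D t / r t))).
  { intros t; symmetry; apply elliptic_profileE. }
  change (elliptic_profile' x) with (- sqrt n3 * q * (k + b) * (S x * C x / (r x)^3)).
  replace (- sqrt n3 * q * (k + b) * (S x * C x / (r x)^3))
    with (sqrt n3 * (- (q * (k + b)) * (S x * C x / (r x)^3))) by ring.
  now apply (is_derive_scal (fun t => D t / r t)).
- rewrite elliptic_profileE; fold (D x) (S x) (r x).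
  replace (peval _ _ _) with (- sqrt n3 * q * (k + b) *
    (q * D x * ((1 - 2 * (S x)^2) * (1 + b * (S x)^2)
                - 3 * b * (S x)^2 * (1 - (S x)^2)) / (r x)^5)).
  { now apply (is_derive_scal (fun t => S t * C t / (r t)^3)). }
  assert (Hr := HR x); assert (Hr2 := R2 x).
  assert (Hd2 := jdn_sqr k Hk (x / (2 * g))); fold (D x) (S x) in Hd2.
  assert (Hs : (sqrt n3)^2 = n3) by (apply pow2_sqrt; lra).
  set (s := sqrt n3) in *; set (T := (S x)^2) in *; clearbody s.
  (* With s D / r^5 factored out, only even powers remain, and both sides become polynomials in T =
     sn^2. *)
  transitivity (s * D x / (r x)^5 *
    (- q^2 * (k + b) * ((1 - 2 * T) * (1 + b * T) - 3 * b * T * (1 - T)))).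
  { field; lra. }
  transitivity (s * D x / (r x)^5 *
    ((w - c^2 / 4) * ((r x)^2)^2 + c / 2 * s^2 * (D x)^2 * (r x)^2
     - 3 / 16 * (s^2)^2 * ((D x)^2)^2)).
  2: { simpl; field; lra. }
  f_equal; rewrite Hr2, Hd2, Hs; unfold q; rewrite g_sqr.
  replace (w - c^2 / 4) with (- (n1 * n2 + n1 * n3 + n2 * n3) / 16) by lra.
  replace c with ((n1 + n2 + n3) / 4) by lra.
  rewrite bE; unfold k; field; lra.
Qed.

Lemma elliptic_profile_0 : elliptic_profile 0 = sqrt n3.
Proof.
assert (Hk := elliptic_modulus_bounds).
unfold elliptic_profile; rewrite jdn_sqr by trivial.
rewrite Rdiv_0_l, jsn_0 by trivial; f_equal; field.
Qed.

Lemma elliptic_profile'_0 : elliptic_profile' 0 = 0.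
Proof.
unfold elliptic_profile'; rewrite Rdiv_0_l, jsn_0 by apply elliptic_modulus_bounds.
unfold Rdiv; ring.
Qed.

Lemma elliptic_profile_bounds (x : R) : 0 <= elliptic_profile x <= sqrt n3.
Proof.
split; [apply sqrt_pos|apply sqrt_le_1_alt].
assert (Hk := elliptic_modulus_bounds).
assert (HR := denom_ge_1 (jsn k (x / (2 * g)))).
rewrite jdn_sqr by trivial.
assert (P := pow2_ge_0 (jsn k (x / (2 * g)))).
apply Rmult_le_reg_r with (1 + b * (jsn k (x / (2 * g)))^2); [lra|].
unfold Rdiv; rewrite Rmult_assoc, Rinv_l, Rmult_1_r by lra.
apply Rmult_le_compat_l; [lra|]; nra.
Qed.

(** The quotient decreases in sn^2, and sn increases up to the quarter period. The end point 2 g K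
    equals L once T = 4 g K = 2 L. *)
Lemma elliptic_profile_decr (x y : R) :
  0 <= x -> x <= y -> y <= 2 * g * ellK k -> elliptic_profile y <= elliptic_profile x.
Proof.
intros Hx Hxy Hy; apply sqrt_le_1_alt.
assert (Hk := elliptic_modulus_bounds).
assert (Hi : 0 < / (2 * g)) by (apply Rinv_0_lt_compat; lra).
destruct (jsn_incr k Hk (x / (2 * g)) (y / (2 * g))) as [H1 H2].
- apply Rmult_le_pos; lra.
- apply Rmult_le_compat_r; lra.
- apply Rmult_le_reg_l with (2 * g); [lra|].
  replace (2 * g * (y / (2 * g))) with y by (field; lra); lra.
- assert (H3 : (jsn k (x / (2 * g)))^2 <= (jsn k (y / (2 * g)))^2)
    by (apply pow_incr; lra).
  assert (Rx := denom_ge_1 (jsn k (x / (2 * g)))).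
  assert (D2 := jdn_sqr k Hk (y / (2 * g))); assert (D1 := jdn_sqr k Hk (x / (2 * g))).
  apply Rmult_le_compat.
  + apply Rmult_le_pos; [lra|apply pow2_ge_0].
  + left; apply Rinv_0_lt_compat; generalize (denom_ge_1 (jsn k (y / (2 * g)))); lra.
  + apply Rmult_le_compat_l; [lra|]; nra.
  + apply Rinv_le_contravar; [lra|]; nra.
Qed.

End EllipticProfile.

(** * Estimates of the complete elliptic integral *)

Lemma ellK_le (k : R) : 0 <= k < 1 -> ellK k <= PI / 2 / sqrt (1 - k).
Proof.
intros Hk; destruct (ellF_sub k Hk 0 (PI / 2)) as (xi & _ & E).
rewrite ellF_0, 2!Rminus_0_r in E; unfold ellK; rewrite E, Rmult_comm.
assert (P := PI_RGT_0); apply Rmult_le_compat_l; [lra|].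
apply Rinv_le_contravar; [apply sqrt_lt_R0; lra|].
apply sqrt_le_1_alt, ell_radicand_bounds; trivial.
Qed.

Lemma sin_le_x (x : R) : 0 <= x -> sin x <= x.
Proof.
intros [H|<-]; [left; now apply sin_lt_x|rewrite sin_0; lra].
Qed.

(* X (1 - k sin^2 t) <= X (1 - k) + X (PI/2 - t)^2 <= (sqrt (X (1 - k)) + m (PI/2 - t))^2,
   and the inverse of the last square root has a logarithmic primitive. *)
Lemma ellK_ge (k X m : R) :
  0 <= k < 1 -> 0 < X -> 0 < m -> sqrt X <= m ->
  ln (sqrt (X * (1 - k)) + m * (PI / 2)) - ln (sqrt (X * (1 - k)))
  <= m / sqrt X * ellK k.
Proof.
intros Hk HX Hm HXm.
set (s := sqrt (X * (1 - k))).
assert (Hs : 0 < s) by (apply sqrt_lt_R0, Rmult_lt_0_compat; lra).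
assert (HsX : 0 < sqrt X) by now apply sqrt_lt_R0.
assert (P := PI_RGT_0).
set (G t := - ln (s + m * (PI / 2 - t)) - m / sqrt X * ellF k t).
set (dG t := m / (s + m * (PI / 2 - t)) - m / sqrt X * / sqrt (1 - k * (sin t)^2)).
(* Because s > 0, the argument of the logarithm stays positive up to the end point PI / 2. *)
assert (H : forall t, t <= PI / 2 -> is_derive G t (dG t)).
{ intros t Ht; assert (0 <= m * (PI / 2 - t)) by (apply Rmult_le_pos; lra).
  assert (E := ellF_is_derive k Hk t); unfold G, dG; auto_derive.
  - split; [lra|]; split; [eexists; exact E|trivial].
  - rewrite (is_derive_unique (fun x : R => ellF k x) _ _ E); field.
    repeat split; try lra.
    apply Rgt_not_eq, sqrt_lt_R0; generalize (ell_radicand_bounds k Hk t); lra. }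
destruct (MVT_gen G 0 (PI / 2) dG) as (t & Ht & E).
- rewrite Rmin_left, Rmax_right by lra; intros x Hx; apply H; lra.
- rewrite Rmin_left, Rmax_right by lra; intros x Hx.
  apply derivable_continuous_pt; eexists; apply is_derive_Reals, H; lra.
- rewrite Rmin_left, Rmax_right in Ht by lra.
  assert (HdG : dG t <= 0).
  { unfold dG.
    assert (Hr := ell_radicand_bounds k Hk t).
    assert (Hr0 : 0 < sqrt (1 - k * (sin t)^2)) by (apply sqrt_lt_R0; lra).
    assert (Hu : 0 <= m * (PI / 2 - t)) by (apply Rmult_le_pos; lra).
    assert (L : sqrt X * sqrt (1 - k * (sin t)^2) <= s + m * (PI / 2 - t)).
    { rewrite <- sqrt_mult_alt by lra.
      rewrite <- (sqrt_pow2 (s + _)) by lra; apply sqrt_le_1_alt.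
      assert (C2 : (cos t)^2 <= (PI / 2 - t)^2).
      { apply pow_incr; rewrite cos_sin; split.
        - rewrite <- cos_sin; apply cos_ge_0; lra.
        - rewrite <- cos_sin, <- sin_shift; apply sin_le_x; lra. }
      assert (SC := sin2_cos2 t); unfold Rsqr in SC.
      assert (s^2 = X * (1 - k)) by (apply pow2_sqrt; apply Rmult_le_pos; lra).
      assert (Xm : X <= m^2).
      { rewrite <- (pow2_sqrt X) by lra; apply pow_incr; lra. }
      assert (B := pow2_ge_0 (PI / 2 - t)); assert (B' := pow2_ge_0 (cos t)).
      assert (X * (PI / 2 - t)^2 <= (m * (PI / 2 - t))^2)
        by (rewrite Rpow_mult_distr; apply Rmult_le_compat_r; trivial).
      assert (k * (cos t)^2 <= (PI / 2 - t)^2) by nra.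
      assert (X * (k * (cos t)^2) <= X * (PI / 2 - t)^2)
        by (apply Rmult_le_compat_l; lra).
      replace (X * (1 - k * sin t ^ 2)) with (X * (1 - k) + X * (k * (cos t)^2)) by
        (replace ((cos t)^2) with (1 - (sin t)^2) by (simpl; lra); ring).
      assert (0 <= s * (m * (PI / 2 - t))) by (apply Rmult_le_pos; lra).
      lra. }
    apply Rle_minus; unfold Rdiv; rewrite Rmult_assoc.
    apply Rmult_le_compat_l; [lra|].
    rewrite <- Rinv_mult; apply Rinv_le_contravar; trivial.
    now apply Rmult_lt_0_compat. }
  unfold G in E; rewrite ellF_0 in E; fold (ellK k) in E.
  rewrite Rminus_diag, Rmult_0_r, Rplus_0_r, !Rminus_0_r in E; nra.
Qed.

Lemma inv_sqrt_lipschitz (mu x y : R) : 0 < mu -> mu <= x -> mu <= y ->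
  Rabs (/ sqrt x - / sqrt y) <= Rabs (x - y) / (mu * sqrt mu).
Proof.
intros Hmu Hx Hy.
assert (H0 : 0 < sqrt mu) by now apply sqrt_lt_R0.
assert (H1 : sqrt mu <= sqrt x) by now apply sqrt_le_1_alt.
assert (H2 : sqrt mu <= sqrt y) by now apply sqrt_le_1_alt.
assert (E : / sqrt x - / sqrt y = (y - x) * / (sqrt x * sqrt y * (sqrt x + sqrt y))).
{ replace (y - x) with ((sqrt y)^2 - (sqrt x)^2) by (rewrite !pow2_sqrt; lra).
  field; lra. }
rewrite E, Rabs_mult, Rabs_minus_sym.
apply Rmult_le_compat_l; [apply Rabs_pos|].
assert (H3 : mu * sqrt mu <= sqrt x * sqrt y * (sqrt x + sqrt y)).
{ rewrite <- (pow2_sqrt mu) at 1 by lra.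
  assert (sqrt mu * sqrt mu <= sqrt x * sqrt y) by nra.
  apply Rmult_le_compat; try lra; nra. }
assert (0 < mu * sqrt mu) by now apply Rmult_lt_0_compat.
rewrite Rabs_pos_eq; [now apply Rinv_le_contravar|].
left; apply Rinv_0_lt_compat; lra.
Qed.

(** Mean value theorem for [ellF k - ellF k'], whose derivative is a difference of inverse square
    roots of quantities at least 1 - q. It provides the continuity of the period map. *)
Lemma ellK_lipschitz (q : R) : q < 1 ->
  exists C, 0 <= C /\ forall k k', 0 <= k <= q -> 0 <= k' <= q ->
  Rabs (ellK k - ellK k') <= C * Rabs (k - k').
Proof.
intros Hq; set (mu := 1 - q).
assert (Hmu : 0 < mu) by (unfold mu; lra).
assert (Hm : 0 < mu * sqrt mu) by (apply Rmult_lt_0_compat; trivial; now apply sqrt_lt_R0).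
assert (P := PI_RGT_0).
exists (PI / 2 / (mu * sqrt mu)); split; [left; apply Rdiv_lt_0_compat; lra|].
intros k k' Hk Hk'.
assert (D : forall t, is_derive (fun t => ellF k t - ellF k' t) t
  (/ sqrt (1 - k * (sin t)^2) - / sqrt (1 - k' * (sin t)^2))).
{ intros t; apply @is_derive_minus; apply ellF_is_derive; lra. }
destruct (MVT_gen (fun t => ellF k t - ellF k' t) 0 (PI / 2)
  (fun t => / sqrt (1 - k * (sin t)^2) - / sqrt (1 - k' * (sin t)^2))) as (t & _ & E).
- intros t _; apply D.
- intros t _; apply derivable_continuous_pt; eexists; apply is_derive_Reals, D.
- cbv beta in E; rewrite 2!ellF_0, !Rminus_0_r in E; unfold ellK.
  rewrite E, Rabs_mult, (Rabs_pos_eq (PI / 2)) by lra.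
  assert (S := sin_sqr_bounds t).
  assert (Rabs (/ sqrt (1 - k * (sin t)^2) - / sqrt (1 - k' * (sin t)^2))
    <= Rabs (k - k') / (mu * sqrt mu)).
  { eapply Rle_trans;
      [apply (inv_sqrt_lipschitz mu); [exact Hmu|unfold mu; nra|unfold mu; nra]|].
    apply Rmult_le_compat_r; [left; now apply Rinv_0_lt_compat|].
    replace (_ - _) with (- ((k - k') * (sin t)^2)) by ring.
    rewrite Rabs_Ropp, Rabs_mult, (Rabs_pos_eq ((sin t)^2)) by lra.
    generalize (Rabs_pos (k - k')); nra. }
  replace (PI / 2 / (mu * sqrt mu) * Rabs (k - k'))
    with (Rabs (k - k') / (mu * sqrt mu) * (PI / 2)) by (unfold Rdiv; ring).
  apply Rmult_le_compat_r; lra.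
Qed.

(** * The limit profile and the period map *)

Definition admissible (w c : R) : Prop := w > c^2 / 4 \/ (w = c^2 / 4 /\ c > 0).

Lemma cosh_sinh_sqr (x : R) : (cosh x)^2 - (sinh x)^2 = 1.
Proof.
unfold cosh, sinh.
replace (((exp x + exp (- x)) / 2)^2 - ((exp x - exp (- x)) / 2)^2)
  with (exp x * exp (- x)) by field.
rewrite <- exp_plus, Rplus_opp_r; apply exp_0.
Qed.

Lemma cosh_ge_1 (x : R) : 1 <= cosh x.
Proof.
assert (H := cosh_sinh_sqr x); assert (P := pow2_ge_0 (sinh x)).
assert (0 < cosh x).
{ unfold cosh; generalize (exp_pos x) (exp_pos (- x)); lra. }
nra.
Qed.

Lemma cosh_ge_linear (x : R) : (1 + x) / 2 <= cosh x.
Proof.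
unfold cosh; generalize (exp_ineq1_le x) (exp_pos (- x)); lra.
Qed.

(** The exponentially decaying soliton. Over the common denominator h^5, with sinh^2 replaced by
    cosh^2 - 1, the equation is a polynomial identity in cosh. *)
Lemma sech_profile (w c q l : R) :
  0 < q -> q^2 = w -> 0 < l -> l^2 = 4 * w - c^2 -> c < 2 * q ->
  profile w c (fun x => l / sqrt (q * cosh (l * x) - c / 2))
    (fun x => - (l^2 * q / 2) * (sinh (l * x) / (sqrt (q * cosh (l * x) - c / 2))^3)).
Proof.
intros Hq Hw Hl Hl2 Hc.
set (h x := sqrt (q * cosh (l * x) - c / 2)).
assert (Hr : forall x, 0 < q * cosh (l * x) - c / 2).
{ intros x; generalize (cosh_ge_1 (l * x)); nra. }
assert (Hh : forall x, 0 < h x) by (intros x; now apply sqrt_lt_R0).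
assert (h2 : forall x, (h x)^2 = q * cosh (l * x) - c / 2).
{ intros x; apply pow2_sqrt, Rlt_le, Hr. }
assert (dh : forall x, is_derive h x (l * (q * sinh (l * x)) / (2 * h x))).
{ intros x; unfold h at 1; auto_derive.
  - specialize (Hr x); lra.
  - change (q * cosh (l * x) + - (c / 2)) with (q * cosh (l * x) - c / 2).
    fold (h x); field; generalize (Hh x); lra. }
split; intros x; fold (h x).
- change (is_derive (fun x => l / h x) x (- (l^2 * q / 2) * (sinh (l * x) / (h x)^3))).
  auto_derive.
  + split; [eexists; apply dh|]; split; [generalize (Hh x); lra|trivial].
  + rewrite (is_derive_unique (fun t : R => h t) _ _ (dh x)).
    field; generalize (Hh x); lra.
- change (is_derive (fun x => - (l^2 * q / 2) * (sinh (l * x) / (h x)^3)) x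
    (peval (nlf w c) (l / h x) 0)).
  auto_derive.
  + split; [eexists; apply dh|]; split; [|trivial].
    apply Rgt_not_eq; repeat apply Rmult_lt_0_compat; generalize (Hh x); lra.
  + rewrite (is_derive_unique (fun t : R => h t) _ _ (dh x)).
    assert (H := Hh x); assert (H2 := h2 x).
    transitivity (- (l^3 * q / 2) *
      (cosh (l * x) * (h x)^2 - 3 / 2 * q * (sinh (l * x))^2) / (h x)^5); [field; lra|].
    transitivity (l * ((w - c^2 / 4) * ((h x)^2)^2 + c / 2 * l^2 * (h x)^2
      - 3 / 16 * (l^2)^2) / (h x)^5); [|simpl; field; lra].
    unfold Rdiv at 1; apply Rmult_eq_compat_r with (r := / (h x)^5).
    replace ((sinh (l * x))^2) with ((cosh (l * x))^2 - 1)
      by (generalize (cosh_sinh_sqr (l * x)); lra).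
    replace (l^3) with (l * l^2) by ring.
    rewrite H2, Hl2, <- Hw; field.
Qed.

(** The algebraically decaying soliton, at the value of [w] where the linear term of the equation
    vanishes. *)
Lemma algebraic_profile (c : R) : 0 < c ->
  profile (c^2 / 4) c (fun x => 2 * sqrt c / sqrt ((c * x)^2 + 1))
    (fun x => - (2 * sqrt c * c^2) * (x / (sqrt ((c * x)^2 + 1))^3)).
Proof.
intros Hc.
set (h x := sqrt ((c * x)^2 + 1)).
assert (Hr : forall x, 0 < (c * x)^2 + 1) by (intros x; generalize (pow2_ge_0 (c * x)); lra).
assert (Hh : forall x, 0 < h x) by (intros x; now apply sqrt_lt_R0).
assert (h2 : forall x, (h x)^2 = (c * x)^2 + 1).
{ intros x; apply pow2_sqrt, Rlt_le, Hr. }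
assert (dh : forall x, is_derive h x (c^2 * x / h x)).
{ intros x; unfold h at 1; auto_derive.
  - specialize (Hr x); simpl in Hr; lra.
  - replace (c * x * (c * x * 1) + 1) with ((c * x)^2 + 1) by ring.
    fold (h x); field; generalize (Hh x); lra. }
assert (Hs : (sqrt c)^2 = c) by (apply pow2_sqrt; lra).
split; intros x; fold (h x).
- change (is_derive (fun x => 2 * sqrt c / h x) x (- (2 * sqrt c * c^2) * (x / (h x)^3))).
  auto_derive.
  + split; [eexists; apply dh|]; split; [generalize (Hh x); lra|trivial].
  + rewrite (is_derive_unique (fun t : R => h t) _ _ (dh x)).
    field; generalize (Hh x); lra.
- change (is_derive (fun x => - (2 * sqrt c * c^2) * (x / (h x)^3)) x
    (peval (nlf (c^2 / 4) c) (2 * sqrt c / h x) 0)).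
  auto_derive.
  + split; [eexists; apply dh|]; split; [|trivial].
    apply Rgt_not_eq; repeat apply Rmult_lt_0_compat; generalize (Hh x); lra.
  + rewrite (is_derive_unique (fun t : R => h t) _ _ (dh x)).
    assert (H := Hh x); assert (H2 := h2 x).
    transitivity (- (2 * sqrt c * c^2) * ((h x)^2 - 3 * (c * x)^2) / (h x)^5);
      [field; lra|].
    transitivity (2 * sqrt c * (2 * c * (sqrt c)^2 * (h x)^2
      - 3 * ((sqrt c)^2)^2) / (h x)^5); [|simpl; field; lra].
    unfold Rdiv at 1; apply Rmult_eq_compat_r with (r := / (h x)^5).
    rewrite H2, Hs; field.
Qed.

Section PeriodMap.

Context (w c : R) (Hwc : admissible w c).

Lemma admissible_sqrt :
  0 < sqrt w /\ (sqrt w)^2 = w /\ - (2 * sqrt w) < c <= 2 * sqrt w.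
Proof.
assert (Hc := pow2_ge_0 c).
assert (Hw : 0 < w).
{ destruct Hwc as [H|[H1 H2]]; [lra|].
  assert (0 < c^2) by (apply pow_lt; lra); lra. }
assert (Hq : 0 < sqrt w) by now apply sqrt_lt_R0.
assert (Hq2 : (sqrt w)^2 = w) by (apply pow2_sqrt; lra).
split; [exact Hq|split; [exact Hq2|]].
destruct Hwc as [H|[H1 H2]]; split; nra.
Qed.

Let q := sqrt w.

(** [alpha1] is the larger root of s^2 - 4 c s + 4 c^2 - 16 w, the cofactor of s = u^2 in -16
    [pot]. *)
Lemma pot_alpha1 : pot w c (sqrt (alpha1 w c)) = 0.
Proof.
destruct admissible_sqrt as (Hq & Hq2 & Hc); unfold pot, alpha1; fold q in Hq, Hq2, Hc |- *.
set (s := sqrt _); assert (Hs : s^2 = 4 * q + 2 * c) by (apply pow2_sqrt; lra).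
replace (s^4) with ((s^2)^2) by ring; replace (s^6) with ((s^2)^3) by ring.
rewrite Hs, <- Hq2; field.
Qed.

Lemma Phi_homoclinic :
  exists z', homoclinic w c (sqrt (alpha1 w c)) (Phi w c) z' /\
    Phi w c 0 = sqrt (alpha1 w c).
Proof.
destruct admissible_sqrt as (Hq & Hq2 & Hc); fold q in Hq, Hq2, Hc.
destruct (Rlt_dec (c^2 / 4) w) as [Hlt|Hge].
- set (l := sqrt (4 * w - c^2)).
  assert (Hl : 0 < l) by (apply sqrt_lt_R0; lra).
  assert (Hl2 : l^2 = 4 * w - c^2) by (apply pow2_sqrt; lra).
  assert (Hc2 : c < 2 * q) by nra.
  assert (Hr : forall x, q - c / 2 <= q * cosh (l * x) - c / 2).
  { intros x; generalize (cosh_ge_1 (l * x)); nra. }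
  assert (E0 : forall x, Phi w c x = sqrt (l^2 / (q * cosh (l * x) - c / 2))).
  { intros x; unfold Phi; destruct (Rlt_dec (c^2 / 4) w); [|contradiction].
    fold q l; rewrite Hl2; do 2 f_equal; field; lra. }
  assert (E : forall x, Phi w c x = l / sqrt (q * cosh (l * x) - c / 2)).
  { intros x; specialize (Hr x).
    rewrite E0, sqrt_div_alt, sqrt_pow2 by lra; reflexivity. }
  assert (P0 : Phi w c 0 = sqrt (alpha1 w c)).
  { rewrite E0, Rmult_0_r, cosh_0; f_equal; unfold alpha1; fold q.
    rewrite Hl2, <- Hq2; field; lra. }
  eexists; split; [|exact P0].
  destruct (sech_profile w c q l Hq Hq2 Hl Hl2 Hc2) as [D1 D2].
  split; [split|split; [|split; [|split]]].
  + intros x; apply is_derive_ext with (2 := D1 x); intros t; symmetry; apply E.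
  + intros x; rewrite E; apply D2.
  + intros x; split; [apply sqrt_pos|].
    rewrite <- P0, 2!E0, Rmult_0_r, cosh_0, Rmult_1_r; apply sqrt_le_1_alt.
    apply Rmult_le_compat_l; [apply pow2_ge_0|].
    apply Rinv_le_contravar; [lra|apply Hr].
  + cbv beta; rewrite Rmult_0_r, sinh_0; unfold Rdiv; ring.
  + rewrite P0; apply pot_alpha1.
  + intros eta Heta.
    set (y := l^2 / eta^2).
    assert (He2 : 0 < eta^2) by now apply pow_lt.
    assert (Hy : 0 < y) by (apply Rdiv_lt_0_compat; trivial; now apply pow_lt).
    (* With cosh t >= (1 + t) / 2, this threshold makes q cosh (l x) - c / 2 at least y = l^2 /
       eta^2. *)
    exists (2 * (y + Rabs c) / (q * l)).
    assert (Pc := Rabs_pos c); assert (Lc := Rle_abs c).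
    split; [left; apply Rdiv_lt_0_compat; [lra|now apply Rmult_lt_0_compat]|].
    intros x Hx; rewrite E0, <- (sqrt_pow2 eta) by lra; apply sqrt_le_1_alt.
    assert (Hcx := cosh_ge_linear (l * x)).
    assert (Hx2 : 2 * (y + Rabs c) <= q * (l * x)).
    { apply Rle_trans with (q * l * (2 * (y + Rabs c) / (q * l))).
      - right; field; lra.
      - rewrite <- Rmult_assoc; apply Rmult_le_compat_l; trivial.
        left; now apply Rmult_lt_0_compat. }
    assert (y <= q * cosh (l * x) - c / 2) by nra.
    replace (eta^2) with (l^2 / y) by (unfold y; field; lra).
    apply Rmult_le_compat_l; [apply pow2_ge_0|now apply Rinv_le_contravar].
- destruct Hwc as [H|[Hw Hc0]]; [lra|].
  assert (Hqc : q = c / 2).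
  { unfold q; rewrite Hw; replace (c^2 / 4) with ((c / 2)^2) by field.
    apply sqrt_pow2; lra. }
  assert (E0 : forall x, Phi w c x = sqrt (4 * c / ((c * x)^2 + 1))).
  { intros x; unfold Phi; destruct (Rlt_dec (c^2 / 4) w); [contradiction|reflexivity]. }
  assert (E : forall x, Phi w c x = 2 * sqrt c / sqrt ((c * x)^2 + 1)).
  { intros x; rewrite E0, sqrt_div_alt by (generalize (pow2_ge_0 (c * x)); lra).
    rewrite sqrt_mult_alt by lra; replace 4 with (2^2) by ring.
    now rewrite sqrt_pow2 by lra. }
  assert (A1 : alpha1 w c = 4 * c) by (unfold alpha1; fold q; lra).
  assert (P0 : Phi w c 0 = sqrt (alpha1 w c)).
  { rewrite E0, A1; f_equal; field. }
  eexists; split; [|exact P0].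
  destruct (algebraic_profile c) as [D1 D2]; [lra|].
  split; [split|split; [|split; [|split]]].
  + intros x; apply is_derive_ext with (2 := D1 x); intros t; symmetry; apply E.
  + intros x; rewrite E, Hw; apply D2.
  + intros x; split; [apply sqrt_pos|].
    rewrite E0, A1; apply sqrt_le_1_alt.
    assert (H := pow2_ge_0 (c * x)).
    apply Rmult_le_reg_r with ((c * x)^2 + 1); [lra|].
    unfold Rdiv; rewrite Rmult_assoc, Rinv_l by lra; nra.
  + unfold Rdiv; ring.
  + rewrite P0; apply pot_alpha1.
  + intros eta Heta.
    assert (He2 : 0 < eta^2) by now apply pow_lt.
    assert (HN : 0 < 4 / eta^2) by (apply Rdiv_lt_0_compat; lra).
    (* As c x <= (c x)^2 + 1, having eta^2 x >= 4 gives 4 c <= eta^2 ((c x)^2 + 1). *)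
    exists (4 / eta^2); split; [lra|].
    intros x Hx; rewrite E0, <- (sqrt_pow2 eta) by lra; apply sqrt_le_1_alt.
    assert (H := pow2_ge_0 (c * x)).
    apply Rmult_le_reg_r with ((c * x)^2 + 1); [lra|].
    unfold Rdiv; rewrite Rmult_assoc, Rinv_l by lra.
    assert (4 <= eta^2 * x).
    { apply Rle_trans with (eta^2 * (4 / eta^2)); [right; field; lra|].
      apply Rmult_le_compat_l; lra. }
    assert (c * x <= (c * x)^2 + 1) by (generalize (pow2_ge_0 (c * x - 1)); nra).
    assert (4 * c <= eta^2 * (c * x)) by nra.
    nra.
Qed.

Lemma alpha_bounds : 0 < alpha0 w c < alpha1 w c.
Proof.
destruct admissible_sqrt as (Hq & Hq2 & Hc); unfold alpha0, alpha1; fold q in Hq, Hq2, Hc |- *.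
assert (Hr : 0 <= 48 * w + 4 * c^2) by (generalize (pow2_ge_0 c); nra).
assert (Hr2 := pow2_sqrt _ Hr); assert (Hr0 := sqrt_pos (48 * w + 4 * c^2)).
set (r := sqrt (48 * w + 4 * c^2)) in *; clearbody r.
assert (0 < 4 * c + r) by nra.
(* (12 q + 2 c)^2 - r^2 = 48 q (2 q + c) > 0. *)
assert (r < 12 * q + 2 * c) by nra.
lra.
Qed.

Lemma Apoly_eq (e : R) :
  Apoly w c e = (e - 4 * c)^2 + 4 * ((alpha1 w c - e) * (e - 2 * c + 4 * q)).
Proof.
destruct admissible_sqrt as (_ & Hq2 & _); unfold Apoly, alpha1; fold q in Hq2 |- *.
rewrite <- Hq2; ring.
Qed.

Lemma eta_sum (e : R) : eta1 w c e + eta2 w c e = 4 * c - e.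
Proof. unfold eta1, eta2; field. Qed.

Lemma eta_mul (e : R) : 0 <= Apoly w c e ->
  - (eta1 w c e * eta2 w c e) = (alpha1 w c - e) * (e - 2 * c + 4 * q).
Proof.
intros HA; assert (E := pow2_sqrt _ HA); rewrite Apoly_eq in E at 2.
unfold eta1, eta2; nra.
Qed.

(** Each end of the interval has its own role: e < alpha1 gives A > (e - 4 c)^2, hence eta1 < 0 <
    eta2, and e > alpha0 gives A < (3 e - 4 c)^2, hence eta2 < e. *)
Lemma eta_order (e : R) : alpha0 w c < e < alpha1 w c ->
  0 < Apoly w c e /\ eta1 w c e < 0 /\ 0 < eta2 w c e /\ eta2 w c e < e.
Proof.
intros He; destruct alpha_bounds as [H0 H1].
destruct admissible_sqrt as (Hq & Hq2 & Hc); fold q in Hq, Hq2, Hc.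
assert (HP : 0 < (alpha1 w c - e) * (e - 2 * c + 4 * q))
  by (apply Rmult_lt_0_compat; lra).
assert (HA : (e - 4 * c)^2 < Apoly w c e) by (rewrite Apoly_eq; lra).
assert (HA0 : 0 < Apoly w c e) by (generalize (pow2_ge_0 (e - 4 * c)); lra).
assert (E := pow2_sqrt _ (Rlt_le _ _ HA0)); assert (S := sqrt_lt_R0 _ HA0).
assert (Hr : 0 <= 48 * w + 4 * c^2) by (generalize (pow2_ge_0 c); nra).
assert (Hr2 := pow2_sqrt _ Hr); assert (Hr0 := sqrt_pos (48 * w + 4 * c^2)).
assert (H3 : sqrt (48 * w + 4 * c^2) < 3 * e - 4 * c) by (unfold alpha0 in He; lra).
assert (H4 : 48 * w + 4 * c^2 < (3 * e - 4 * c)^2) by nra.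
assert (H5 : Apoly w c e < (3 * e - 4 * c)^2) by (unfold Apoly; lra).
unfold eta1, eta2; set (s := sqrt (Apoly w c e)) in *; clearbody s.
split; [exact HA0|]; repeat split; nra.
Qed.

Lemma modk2_bounds (e : R) : alpha0 w c < e < alpha1 w c -> 0 <= modk2 w c e < 1.
Proof.
intros He; destruct (eta_order e He) as (_ & H1 & H2 & H3).
exact (elliptic_modulus_bounds _ _ _ (conj H1 (conj H2 H3))).
Qed.

(* T = 8 int_0^(PI/2) dt / sqrt (X cos^2 t + Y sin^2 t); eta2(alpha1) = 0 makes Y vanish at
   alpha1 while X stays bounded, in the degenerate case as well. *)
Let X (e : R) : R := e * (eta2 w c e - eta1 w c e).
Let Y (e : R) : R := eta2 w c e * (e - eta1 w c e).

Let XY_pos (e : R) : alpha0 w c < e < alpha1 w c -> 0 < X e /\ 0 < Y e.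
Proof.
intros He; destruct (eta_order e He) as (_ & H1 & H2 & H3).
split; apply Rmult_lt_0_compat; lra.
Qed.

Let YE (e : R) : alpha0 w c < e < alpha1 w c -> X e * (1 - modk2 w c e) = Y e.
Proof.
intros He; destruct (eta_order e He) as (_ & H1 & H2 & H3).
unfold X, Y, modk2; field; lra.
Qed.

Let TperE (e : R) : Tper w c e = 8 / sqrt (X e) * ellK (modk2 w c e).
Proof. unfold Tper, gfac; fold (X e); unfold Rdiv; ring. Qed.

(** Bounding the integrand of [ellK] by its value at PI / 2 turns T into 4 PI / sqrt Y, and Y >= -
    eta1 eta2 = (alpha1 - e) (e - 2 c + 4 q) >= d alpha0. *)
Lemma Tper_le (d e : R) : 0 < d -> alpha0 w c < e -> e <= alpha1 w c - d ->
  Tper w c e <= 4 * PI / sqrt (d * alpha0 w c).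
Proof.
intros Hd He He'; destruct alpha_bounds as [H0 H1].
destruct admissible_sqrt as (Hq & Hq2 & Hc); fold q in Hq, Hq2, Hc.
assert (He2 : alpha0 w c < e < alpha1 w c) by lra.
destruct (XY_pos e He2) as [HX HY]; assert (Hk := modk2_bounds e He2).
destruct (eta_order e He2) as (HA & N1 & N2 & _).
assert (HYd : d * alpha0 w c <= Y e).
{ apply Rle_trans with (- (eta1 w c e * eta2 w c e)).
  - rewrite eta_mul by lra; apply Rmult_le_compat; lra.
  - unfold Y; nra. }
assert (P := PI_RGT_0).
assert (SX : 0 < sqrt (X e)) by now apply sqrt_lt_R0.
apply Rle_trans with (4 * PI / sqrt (Y e)).
- rewrite TperE, <- (YE e He2), sqrt_mult_alt by lra.
  assert (0 < sqrt (1 - modk2 w c e)) by (apply sqrt_lt_R0; lra).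
  replace (4 * PI / _) with (8 / sqrt (X e) * (PI / 2 / sqrt (1 - modk2 w c e)))
    by (field; lra).
  apply Rmult_le_compat_l; [left; apply Rdiv_lt_0_compat; lra|now apply ellK_le].
- apply Rmult_le_compat_l; [lra|]; apply Rinv_le_contravar.
  + apply sqrt_lt_R0, Rmult_lt_0_compat; lra.
  + now apply sqrt_le_1_alt.
Qed.

Lemma eta_continuous (e : R) : continuous (eta1 w c) e /\ continuous (eta2 w c) e.
Proof.
assert (A : continuous (fun x => sqrt (Apoly w c x)) e).
{ apply (continuous_comp (Apoly w c) sqrt); [|apply continuous_sqrt].
  apply (ex_derive_continuous (V := R_NormedModule)); unfold Apoly; auto_derive; trivial. }
assert (B : continuous (fun x => - x + 4 * c) e).
{ apply (ex_derive_continuous (V := R_NormedModule)); auto_derive; trivial. }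
split; (apply (continuous_mult (K := R_AbsRing)); [|apply continuous_const]).
- now apply (continuous_minus (V := R_NormedModule)).
- now apply (continuous_plus (V := R_NormedModule)).
Qed.

Lemma eta2_alpha1 : eta2 w c (alpha1 w c) = 0.
Proof.
destruct admissible_sqrt as (Hq & Hq2 & Hc); fold q in Hq, Hq2, Hc.
assert (HA : Apoly w c (alpha1 w c) = (4 * q - 2 * c)^2).
{ rewrite Apoly_eq; unfold alpha1; fold q; ring. }
unfold eta2; rewrite HA, sqrt_pow2 by lra; unfold alpha1; fold q; field.
Qed.

(** Near [alpha1] the logarithmic lower bound [ellK_ge] blows up, since Y tends to 0 there while X
    stays below [Xm]. This supplies the upper end for the intermediate value theorem. *)
Lemma Tper_unbounded (e0 B : R) : e0 < alpha1 w c ->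
  exists e, e0 < e < alpha1 w c /\ alpha0 w c < e /\ B < Tper w c e.
Proof.
intros He0; destruct alpha_bounds as [H0 H1].
(* The maximum of [Apoly] is 64 w + 16 c^2 / 3, and eta2 - eta1 = sqrt A. *)
set (Xm := alpha1 w c * sqrt (64 * w + 6 * c^2)).
destruct admissible_sqrt as (Hq & Hq2 & Hc); fold q in Hq, Hq2, Hc.
assert (Hc2 := pow2_ge_0 c).
assert (HXm : 0 < Xm).
{ apply Rmult_lt_0_compat; [lra|]; apply sqrt_lt_R0; nra. }
set (m := sqrt Xm); assert (Hm : 0 < m) by now apply sqrt_lt_R0.
assert (P := PI_RGT_0).
(* Solves ln (m PI / 2) - ln s = m B / 8, so that Y < s^2 forces T > B. *)
set (s := m * (PI / 2) * exp (- (m / 8 * B))).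
assert (Hs : 0 < s).
{ apply Rmult_lt_0_compat; [apply Rmult_lt_0_compat; lra|apply exp_pos]. }
assert (CY : continuous Y (alpha1 w c)).
{ destruct (eta_continuous (alpha1 w c)) as [C1 C2].
  apply (continuous_mult (K := R_AbsRing)); [exact C2|].
  apply (continuous_minus (V := R_NormedModule)); [apply continuous_id|exact C1]. }
assert (Hs2 : 0 < s^2) by now apply pow_lt.
destruct (proj1 (filterlim_locally Y _) CY (mkposreal _ Hs2)) as [d Hd].
set (e := Rmax (alpha1 w c - d / 2) (Rmax ((e0 + alpha1 w c) / 2)
  ((alpha0 w c + alpha1 w c) / 2))).
assert (Hd0 := cond_pos d).
assert (E1 : alpha1 w c - d / 2 <= e) by apply Rmax_l.
assert (E2 : (e0 + alpha1 w c) / 2 <= e).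
{ apply Rle_trans with (2 := Rmax_r _ _), Rmax_l. }
assert (E3 : (alpha0 w c + alpha1 w c) / 2 <= e).
{ apply Rle_trans with (2 := Rmax_r _ _), Rmax_r. }
assert (E4 : e < alpha1 w c) by (unfold e; repeat apply Rmax_lub_lt; lra).
assert (He : alpha0 w c < e < alpha1 w c) by lra.
clearbody e.
exists e; repeat split; try lra.
destruct (XY_pos e He) as [HX HY]; assert (Hk := modk2_bounds e He).
assert (HYs : Y e < s^2).
{ assert (H : ball (Y (alpha1 w c)) (s^2) (Y e)).
  { apply (Hd e); change (Rabs (e - alpha1 w c) < d); rewrite Rabs_left; lra. }
  change (Rabs (Y e - Y (alpha1 w c)) < s^2) in H.
  unfold Y at 2 in H; rewrite eta2_alpha1, Rmult_0_l, Rminus_0_r in H.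
  apply Rle_lt_trans with (2 := H), Rle_abs. }
assert (HXm2 : X e <= Xm).
{ unfold X, Xm; apply Rmult_le_compat; try lra.
  - destruct (eta_order e He); lra.
  - unfold eta1, eta2; replace (_ - _) with (sqrt (Apoly w c e)) by field.
    apply sqrt_le_1_alt; unfold Apoly.
    generalize (pow2_ge_0 (3 * e - 4 * c)); lra. }
assert (SX : 0 < sqrt (X e)) by now apply sqrt_lt_R0.
assert (SXm : sqrt (X e) <= m) by now apply sqrt_le_1_alt.
assert (SY : 0 < sqrt (Y e)) by now apply sqrt_lt_R0.
assert (SYs : sqrt (Y e) < s).
{ rewrite <- (sqrt_pow2 s) by lra; apply sqrt_lt_1_alt; lra. }
assert (L := ellK_ge _ (X e) m Hk HX Hm SXm); rewrite YE in L by trivial.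
assert (L2 : m / 8 * B < ln (sqrt (Y e) + m * (PI / 2)) - ln (sqrt (Y e))).
{ assert (ln (sqrt (Y e)) < ln (m * (PI / 2)) - m / 8 * B).
  { replace (ln (m * (PI / 2)) - m / 8 * B) with (ln s).
    - now apply ln_increasing.
    - unfold s; rewrite ln_mult, ln_exp; [ring| |apply exp_pos].
      apply Rmult_lt_0_compat; lra. }
  assert (ln (m * (PI / 2)) < ln (sqrt (Y e) + m * (PI / 2))).
  { apply ln_increasing; [apply Rmult_lt_0_compat|]; lra. }
  lra. }
apply Rmult_lt_reg_l with (m / 8); [lra|].
rewrite TperE; replace (m / 8 * (8 / sqrt (X e) * _))
  with (m / sqrt (X e) * ellK (modk2 w c e)) by (field; lra).
lra.
Qed.

Lemma Tper_continuous (e : R) : alpha0 w c < e < alpha1 w c -> continuous (Tper w c) e.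
Proof.
intros He; destruct (eta_continuous e) as [C1 C2].
destruct (eta_order e He) as (_ & N1 & N2 & N3).
destruct (XY_pos e He) as [HX _].
assert (Cid : continuous (fun x : R => x) e) by apply continuous_id.
assert (CX : continuous X e).
{ apply (continuous_mult (K := R_AbsRing)); [exact Cid|].
  now apply (continuous_minus (V := R_NormedModule)). }
assert (Ck : continuous (modk2 w c) e).
{ apply (continuous_mult (K := R_AbsRing) (fun x => - eta1 w c x * (x - eta2 w c x))).
  - apply (continuous_mult (K := R_AbsRing)).
    + now apply (continuous_opp (V := R_NormedModule)).
    + now apply (continuous_minus (V := R_NormedModule)).
  - apply (continuous_comp X Rinv); [exact CX|].
    apply continuous_Rinv; lra. }
assert (Hk := modk2_bounds e He).
set (k := modk2 w c e) in *.
(* Midway between [k] and 1, so that squared moduli within (1 - k) / 2 of [k] stay in the range of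
   the Lipschitz bound. *)
destruct (ellK_lipschitz ((1 + k) / 2)) as (C & HC & Lip); [lra|].
assert (CK : continuous (fun x => ellK (modk2 w c x)) e).
{ apply filterlim_locally; intros eps.
  assert (Hd : 0 < Rmin ((1 - k) / 2) (eps / (C + 1))).
  { apply Rmin_pos; [lra|]; apply Rdiv_lt_0_compat; [apply cond_pos|lra]. }
  assert (L1 := proj1 (filterlim_locally (modk2 w c) _) Ck (mkposreal _ Hd)).
  assert (L2 : locally e (fun x => alpha0 w c < x < alpha1 w c)).
  { apply filter_and; [apply open_gt|apply open_lt]; lra. }
  generalize (filter_and _ _ L1 L2); apply filter_imp; intros x [B1 Hx].
  change (Rabs (modk2 w c x - k) < Rmin ((1 - k) / 2) (eps / (C + 1))) in B1.
  change (Rabs (ellK (modk2 w c x) - ellK k) < eps).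
  assert (Hkx := modk2_bounds x Hx).
  assert (B2 := Rlt_le_trans _ _ _ B1 (Rmin_l _ _)).
  assert (B3 := Rlt_le_trans _ _ _ B1 (Rmin_r _ _)).
  apply Rabs_def2 in B2.
  apply Rle_lt_trans with (C * Rabs (modk2 w c x - k)); [apply Lip; lra|].
  assert (B4 := Rabs_pos (modk2 w c x - k)).
  apply Rle_lt_trans with ((C + 1) * Rabs (modk2 w c x - k)); [nra|].
  apply Rlt_le_trans with ((C + 1) * (eps / (C + 1))).
  - apply Rmult_lt_compat_l; lra.
  - right; field; lra. }
apply (continuous_mult (K := R_AbsRing)); [|exact CK].
apply (continuous_mult (K := R_AbsRing)); [apply continuous_const|].
apply (continuous_mult (K := R_AbsRing)); [apply continuous_const|].
apply (continuous_comp (fun x => sqrt (X x)) Rinv).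
- apply (continuous_comp X sqrt); [exact CX|apply continuous_sqrt].
- apply continuous_Rinv, Rgt_not_eq, sqrt_lt_R0, HX.
Qed.

Lemma eta3L_near_alpha1 (d : R) : 0 < d ->
  exists M, forall L, M < L ->
  alpha0 w c < eta3L w c L < alpha1 w c /\ Tper w c (eta3L w c L) = 2 * L /\
  alpha1 w c - d < eta3L w c L.
Proof.
intros Hd; destruct alpha_bounds as [H0 H1].
set (e0 := (alpha0 w c + alpha1 w c) / 2).
assert (He0 : alpha0 w c < e0 < alpha1 w c) by (unfold e0; lra).
(* 2 L > T(e0) yields a root by the intermediate value theorem, which justifies the choice made by
   [eta3L]; 2 L above the bound of [Tper_le] excludes roots up to alpha1 - d. *)
exists (Rmax (Tper w c e0) (4 * PI / sqrt (d * alpha0 w c)) / 2); intros L HL.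
assert (L1 := Rmax_l (Tper w c e0) (4 * PI / sqrt (d * alpha0 w c))).
assert (L2 := Rmax_r (Tper w c e0) (4 * PI / sqrt (d * alpha0 w c))).
assert (Ex : exists e, alpha0 w c < e < alpha1 w c /\ Tper w c e = 2 * L).
{ destruct (Tper_unbounded e0 (2 * L)) as (e1 & E1 & E1' & E2); [lra|].
  destruct (IVT_Rbar_incr (Tper w c) e0 e1 (Tper w c e0) (Tper w c e1) (2 * L))
    as (e & I1 & I2 & E); try (simpl; lra).
  - apply is_lim_continuity, continuity_pt_filterlim, Tper_continuous; lra.
  - apply is_lim_continuity, continuity_pt_filterlim, Tper_continuous; lra.
  - intros x X1 X2; simpl in X1, X2.
    apply continuity_pt_filterlim, Tper_continuous; lra.
  - simpl in I1, I2; exists e; split; [lra|exact E]. }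
assert (S : alpha0 w c < eta3L w c L < alpha1 w c /\ Tper w c (eta3L w c L) = 2 * L).
{ unfold eta3L; now apply epsilon_spec. }
destruct S as [S1 S2]; repeat split; try lra.
destruct (Rlt_le_dec (alpha1 w c - d) (eta3L w c L)) as [|Hle]; [assumption|].
generalize (Tper_le d _ Hd (proj1 S1) Hle); lra.
Qed.

Lemma PhiL_near_profile (d : R) : 0 < d ->
  exists M, forall L, M < L -> exists y',
  near_profile w c (sqrt (alpha1 w c)) (Phi w c) d L (PhiL w c L) y'.
Proof.
intros Hd; destruct Phi_homoclinic as (_ & _ & P0).
destruct alpha_bounds as [H0 H1].
assert (C : continuous sqrt (alpha1 w c)) by apply continuous_sqrt.
destruct (proj1 (filterlim_locally sqrt _) C (mkposreal d Hd)) as [r Hr].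
destruct (eta3L_near_alpha1 r (cond_pos r)) as [M HM].
exists M; intros L HL; destruct (HM L HL) as (He & HT & Hnear).
set (e := eta3L w c L) in *.
destruct (eta_order e He) as (HA & N1 & N2 & N3).
assert (Hn : eta1 w c e < 0 /\ 0 < eta2 w c e /\ eta2 w c e < e) by easy.
exists (elliptic_profile' (eta1 w c e) (eta2 w c e) e).
(* Holds by conversion. *)
change (PhiL w c L) with (elliptic_profile (eta1 w c e) (eta2 w c e) e).
assert (Hs := eta_sum e).
split; [|split; [|split; [|split]]].
- apply elliptic_profile_ode; trivial; [lra|].
  assert (Hm := eta_mul e (Rlt_le _ _ HA)).
  destruct admissible_sqrt as (_ & Hq2 & _); fold q in Hq2.
  unfold alpha1 in Hm; fold q in Hm.
  (* The second Vieta relation: - eta1 eta2 = 16 w - (e - 2 c)^2 and eta1 + eta2 = 4 c - e. *)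
  transitivity (eta1 w c e * eta2 w c e + e * (eta1 w c e + eta2 w c e)); [|ring].
  rewrite Hs; lra.
- intros x; destruct (elliptic_profile_bounds _ _ _ Hn x) as [B1 B2].
  split; [exact B1|]; apply Rle_trans with (1 := B2), sqrt_le_1_alt; lra.
- now apply elliptic_profile'_0.
- rewrite elliptic_profile_0, P0 by trivial; left.
  apply (Hr e); change (Rabs (e - alpha1 w c) < r); rewrite Rabs_left; lra.
- intros a b Ha Hab Hb; apply elliptic_profile_decr; trivial.
  apply Rle_trans with (1 := Hb).
  apply Rmult_le_reg_l with 2; [lra|]; rewrite <- HT; right.
  unfold Tper, gfac, modk2; ring.
Qed.

End PeriodMap.

Theorem theorem1p3 (w c : R)
  (Hwc : w > c^2 / 4 \/ (w = c^2 / 4 /\ c > 0)) (m : nat) :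
  forall eps : R, eps > 0 ->
  exists M : R, forall L : R, L > M -> L > L0 w c ->
    Rbar_le (CmNorm m L (fun x => PhiL w c L x - Phi w c x)) (Finite eps).
Proof.
intros eps Heps.
destruct (Phi_homoclinic w c Hwc) as (z' & Hz & _).
destruct (near_profile_CmNorm w c _ _ _ m Hz eps Heps) as (d & Hd & H).
destruct (PhiL_near_profile w c Hwc d Hd) as [M HM].
exists M; intros L HL _; destruct (HM L HL) as [y' Hy].
exact (H L _ y' Hy).
Qed.
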